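(* Let $h:[0,+\infty)\to[0,+\infty)$ be an increasing, onto homeomorphism, and let $p>1$ be a real number. Then there exists a homeomorphism $\bar f:\mathbb{C}\to\mathbb{C}$ with the following properties: (i) $\bar f$ is a mapping of finite distortion, with $\mathbb{K}(\cdot,\bar f)\in L^p_{loc}(\mathbb{C})$. (ii) $\bar f(0)=0$ and $\bar f(1)=1$. (iii) For every $\alpha>\frac{3p}{p-1}$ there is a constant $C>0$ such that $|\bar f(x)-\bar f(y)|\geq C|x-y|^\alpha$ for all $x,y\in\mathbb{C}$ with $|x-y|<1$. (iv) There exists a decreasing sequence $\{r_n\}$ of positive numbers, with $r_n\to0^+$ as $n\to\infty$, for which $$|\arg(\bar f(r_n))|\geq r_n^{-\frac1p}\,\log^{\frac12}\left(\frac1{r_n}\right)\,h(r_n)\qquad\text{for all }n.$$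
   Context: A mapping $f:\mathbb{C}\to\mathbb{C}$ is a mapping of finite distortion if $f\in W^{1,1}_{loc}(\mathbb{C};\mathbb{C})$, its Jacobian determinant $J(\cdot,f)=\det(Df)$ is locally integrable, and there is a measurable function $\mathbb{K}(\cdot,f):\mathbb{C}\to[1,+\infty]$ (the distortion function of $f$) such that $|Df(z)|^2\leq \mathbb{K}(z,f)\,J(z,f)$ for almost every $z\in\mathbb{C}$, where $|Df(z)|$ is the operator norm of the differential matrix. Convention for the argument: for a homeomorphism $f:\mathbb{C}\to\mathbb{C}$ with $f(0)=0$ and $f(1)=1$, the function $r\mapsto\arg(f(r))$, $r\in(0,1]$, is the continuous real-valued (not reduced mod $2\pi$) branch of the argument of $f(r)$ along the segment $(0,1]$ normalized by $\arg(f(1))=0$. Thus $|\arg(f(r))|$ measures the winding of the image $f([r,1])$ around the origin. *)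

(* Defs.v *)
From mathcomp Require Import all_boot all_order all_algebra.
From mathcomp Require Import all_classical all_reals all_analysis.
From mathcomp Require Import measurable_realfun.

Set Implicit Arguments.
Unset Strict Implicit.
Unset Printing Implicit Defensive.

Import Order.TTheory GRing.Theory Num.Theory.
Import numFieldNormedType.Exports.

Local Open Scope classical_set_scope.
Local Open Scope ring_scope.

(* The complex plane is R * R, with x + iy encoded as (x, y). Its topology and
   Borel sets are those of the product. The library norm `|z| on R * R is the
   max norm, so the complex modulus is defined separately. *)
Notation plane R := (R * R)%type.

Definition modulus (R : realType) (z : plane R) : R :=
  Num.sqrt (z.1 ^+ 2 + z.2 ^+ 2).

(* The same type, with the measurable structure for which the library states
   lebesgue_measure (the sigma-algebra is again that of Borel sets). *)
Notation mplane R := (measurableTypeR R * measurableTypeR R)%type.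

Definition mu2 (R : realType) : set (mplane R) -> \bar R :=
  (@lebesgue_measure R \x @lebesgue_measure R)%E.

Definition component (R : realType) (i : 'I_2) (z : plane R) : R :=
  if i == 0 then z.1 else z.2.

Definition basis_vec (R : realType) (j : 'I_2) : plane R :=
  if j == 0 then (1, 0) else (0, 1).

Definition homeomorphism (T U : topologicalType) (A : set T) (B : set U)
    (f : T -> U) : Prop :=
  exists g : U -> T,
    [/\ {within A, continuous f}, {within B, continuous g},
        forall x, A x -> B (f x) /\ g (f x) = x &
        forall y, B y -> A (g y) /\ f (g y) = y].

Definition locally_integrable2 (R : realType) (u : plane R -> R) : Prop :=
  forall A : set (plane R), compact A -> (@mu2 R).-integrable A (EFin \o u).

Fixpoint Ck (R : realType) (k : nat) (phi : plane R -> R) : Prop :=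
  if k is k'.+1 then
    forall j : 'I_2,
      (forall z, derivable phi z (basis_vec R j)) /\
      Ck k' (fun z => 'D_(basis_vec R j) phi z)
  else continuous phi.

Definition test_function (R : realType) (phi : plane R -> R) : Prop :=
  (forall k, Ck k phi) /\ compact (closure [set z | phi z != 0]).

Definition weak_partial (R : realType) (j : 'I_2) (u g : plane R -> R) : Prop :=
  forall phi : plane R -> R, test_function phi ->
    (\int[@mu2 R]_z (u z * 'D_(basis_vec R j) phi z)%:E
     = - \int[@mu2 R]_z (g z * phi z)%:E)%E.

(* f is in W^{1,1}_loc and Df is (a representative of) its weak differential;
   row i of Df z is the gradient of the i-th component of f. *)
Definition W11loc_differential (R : realType) (f : plane R -> plane R)
    (Df : plane R -> 'M[R]_2) : Prop :=
  (forall i, locally_integrable2 (fun z => component i (f z))) /\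
  forall i j,
    locally_integrable2 (fun z => Df z i j) /\
    weak_partial j (fun z => component i (f z)) (fun z => Df z i j).

Definition enorm (R : realType) (n : nat) (v : 'cV[R]_n) : R :=
  Num.sqrt (\sum_(i < n) v i 0 ^+ 2).

Definition opnorm (R : realType) (m n : nat) (A : 'M[R]_(m, n)) : R :=
  sup [set enorm (A *m v) | v in [set v : 'cV[R]_n | enorm v <= 1]].

(* f is a mapping of finite distortion with distortion function K. Where
   K z = +oo and J(z, f) = 0 the library convention +oo * 0 = 0 makes the
   distortion inequality say that Df z = 0. *)
Definition finite_distortion (R : realType) (f : plane R -> plane R)
    (K : plane R -> \bar R) : Prop :=
  exists Df : plane R -> 'M[R]_2,
    [/\ W11loc_differential f Df,
        locally_integrable2 (fun z => \det (Df z)),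
        measurable_fun [set: mplane R] K,
        forall z, (1 <= K z)%E &
        {ae @mu2 R, forall z,
          ((opnorm (Df z) ^+ 2)%:E <= K z * (\det (Df z))%:E)%E}].

Definition Lp_loc (R : realType) (p : R) (K : plane R -> \bar R) : Prop :=
  measurable_fun [set: mplane R] K /\
  forall A : set (plane R), compact A ->
    (\int[@mu2 R]_(z in A) (`|K z| `^ p) < +oo)%E.

(* theta is the continuous branch of r |-> arg (f r) on (0, 1] that vanishes
   at 1. The real number r is the point (r, 0); the values of theta outside
   (0, 1] are irrelevant. *)
Definition arg_branch (R : realType) (f : plane R -> plane R)
    (theta : R -> R) : Prop :=
  [/\ {within `]0, 1], continuous theta},
      theta 1 = 0 &
      forall r, 0 < r <= 1 ->
        f (r, 0) = (modulus (f (r, 0)) * cos (theta r),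
                    modulus (f (r, 0)) * sin (theta r))].

(* Main.v *)
(** Identify the plane with C and put t = - ln |z|^2. The map is a spiral
    f(z) = z exp (- A(t) + i B(t)), where A and B are superpositions of C^1 steps
    of heights a_n and b_n located at the points of a sparse sequence T_n. Near
    the circle of radius r_n = exp (- (T_n + 1) / 2), the n-th step of A
    compresses by a factor which is a power of r_n (a_n = T_n / 4), and this is
    what makes the rotation by the angle b_n cheap: the distortion there is of
    order 1 + a_n + b_n^2 / a_n. With b_n = r_n^(-1/p) log^(1/2) (1 / r_n) h(r_n),
    its p-th power integrates to about h(r_n)^(2p) plus a term tending to 0, so
    the sum over n converges if T_n grows fast enough. Away from these annuli f
    is conformal.

    The lower bound holds with exponent 3 < 3p/(p-1), since b_n / a_n is at most a
    multiple of 1 / r_n and A(t) <= t / 2. It also gives injectivity and the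
    continuity of the inverse. Off the origin f is C^1, so its weak derivatives
    are obtained by integrating by parts on almost every line. *)

Require Import Defs.
From mathcomp Require Import all_boot all_order all_algebra.
From mathcomp Require Import all_classical all_reals all_analysis.
From mathcomp Require Import measurable_realfun ring lra.
Import Order.TTheory GRing.Theory Num.Theory.
Import numFieldNormedType.Exports.
Local Open Scope classical_set_scope.
Local Open Scope ring_scope.
Set Implicit Arguments.
Unset Strict Implicit.
Unset Printing Implicit Defensive.

(** * A C^1 step function *)

Section Step.
Variable R : realType.
Implicit Types x y : R.

(** A remainder of order h^2 makes the difference quotient converge at rate |h|. This reaches y *
    |y| at 0, where the product rule does not apply. *)
Lemma is_derive_quadratic (f : R -> R) (x d C : R) :
  (forall h, `|f (h + x) - f x - h * d| <= C * h ^+ 2) -> is_derive x 1 f d.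
Proof.
move=> H.
have Hc : h^-1 *: ((f \o shift x) (h *: (1:R)) - f x) @[h --> (0:R)^'] --> d.
  have C0 : 0 <= C by have := H 1; rewrite expr1n mulr1; apply: le_trans.
  apply/cvgrPdist_le => e e0.
  have d0 : 0 < e / (C + 1) by rewrite divr_gt0// ltr_wpDl.
  near=> h.
  have h0 : h != 0 by near: h; exact: nbhs_dnbhs_neq.
  rewrite /= /GRing.scale /= mulr1.
  have -> : d - h^-1 * (f (h + x) - f x) = - (h^-1 * (f (h + x) - f x - h * d)).
    by field.
  rewrite normrN normrM normrV ?unitfE// ler_pdivrMl ?normr_gt0//.
  apply: le_trans (H h) _.
  have hd : `|h| <= e / (C + 1).
    near: h. apply: dnbhs0_le. exact: d0.
  have -> : h ^+ 2 = `|h| * `|h| by rewrite -normrM -expr2 ger0_norm// sqr_ge0.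
  rewrite mulrCA ler_wpM2l//.
  apply: (@le_trans _ _ ((C + 1) * (e / (C + 1)))).
    apply: ler_pM => //. lra.
  rewrite mulrCA divff ?mulr1//. lra.
apply: DeriveDef; first by apply/cvg_ex; exists d.
exact: cvg_lim Hc.
Unshelve. all: by end_near. Qed.

Lemma is_derive_mul_norm x : is_derive x 1 (fun y : R => y * `|y|) (2 * `|x|).
Proof.
apply: (@is_derive_quadratic _ _ _ 1) => h; rewrite mul1r.
have [x0|x0] := leP 0 x; have [hx|hx] := leP 0 (h + x);
 rewrite ?(ger0_norm x0) ?(ltr0_norm x0) ?(ger0_norm hx) ?(ltr0_norm hx) ler_norml;
   apply/andP; split; nra.
Qed.

(* The quadratic spline 2 (x_+^2 - 2 (x - 1/2)_+^2 + (x - 1)_+^2), with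
   x_+^2 = (x^2 + x |x|) / 2. *)
Definition step x : R :=
  2^-1 + (x * `|x| - 2 * ((x - 2^-1) * `|x - 2^-1|) + (x - 1) * `|x - 1|).

(** The tent of height 2 over [0, 1]; outside that interval the three absolute values cancel. *)
Definition dstep x : R := 2 * `|x| - 4 * `|x - 2^-1| + 2 * `|x - 1|.

Lemma is_derive_step x : is_derive x 1 step (dstep x).
Proof.
have D c : is_derive x 1 (fun y : R => (y - c) * `|y - c|) (2 * `|x - c|).
  have := @is_derive1_comp _ (fun y : R => y * `|y|
    ) (fun y => y - c) x _ _ (is_derive_mul_norm _) (is_deriveB (is_derive_id _ _)
      (is_derive_cst c _ _)).
  by rewrite subr0 mulr1.
have H := is_deriveD (is_derive_cst (2^-1 : R) x (1 : R))
  (is_deriveD (is_deriveB (D 0) (is_deriveZ 2 (D 2^-1))) (D 1)).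
have -> : dstep x = 0 + (2 * `|x - 0| - 2 *: (2 * `|x - 2^-1|) + 2 * `|x - 1|).
  by rewrite /dstep /GRing.scale /= subr0; ring.
apply: near_eq_is_derive H; near=> y.
by rewrite /step !fctE /GRing.scale /= subr0.
Unshelve. all: by end_near. Qed.

Lemma step_le0 x : x <= 0 -> step x = 0.
Proof. by move=> x0; rewrite /step !ler0_norm; lra. Qed.

Lemma step_ge1 x : 1 <= x -> step x = 1.
Proof. by move=> x0; rewrite /step !ger0_norm; lra. Qed.

Lemma dstep_ge0 x : 0 <= dstep x.
Proof.
by rewrite /dstep; case: (ler0P x); case: (ler0P (x - 2^-1)); case: (ler0P (x - 1));
  lra.
Qed.

Lemma dstep_le2 x : dstep x <= 2.
Proof.
by rewrite /dstep; case: (ler0P x); case: (ler0P (x - 2^-1)); case: (ler0P (x - 1));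
  lra.
Qed.

Lemma dstep_eq0 x : x <= 0 \/ 1 <= x -> dstep x = 0.
Proof.
by rewrite /dstep; case: (ler0P x); case: (ler0P (x - 2^-1)); case: (ler0P (x - 1));
  lra.
Qed.

Lemma continuous_dstep : continuous dstep.
Proof.
have D c : continuous (fun y : R => `|y - c|).
  move=> y; apply: (@continuous_comp _ _ _ (fun y : R => y - c) Num.norm).
    by apply: continuousB; [exact: cvg_id|exact: cvg_cst].
  exact: norm_continuous.
have -> : dstep = (fun y => 2 * `|y - 0|) - (fun y => 4 * `|y - 2^-1|
  ) + (fun y => 2 * `|y - 1|).
  by apply/funext => y; rewrite /dstep !fctE subr0.
move=> x; apply: continuousD; first apply: continuousB;
 by apply: continuousM; [exact: cvg_cst|exact: D].
Qed.

Lemma step_homo : {homo step : x y / x <= y}.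
Proof.
move=> x y xy.
have [||c _ E] := @MVT_segment R step dstep x y xy.
- by move=> z _; exact: is_derive_step.
- apply: continuous_subspaceT => z.
  have [/derivable1_diffP d _] := is_derive_step z.
  exact: differentiable_continuous d.
- by rewrite -subr_ge0 E mulr_ge0 ?dstep_ge0// subr_ge0.
Qed.

End Step.

(** * Superpositions of sparse steps *)

Section Train.
Variables (R : realType) (T : nat -> R).
Hypothesis T0 : 1 <= T 0.
Hypothesis TS : forall n, 2 * T n <= T n.+1.
Implicit Types (c : nat -> R) (s t : R).

(** A series written as a finite sum: T n >= n + 1, so every step with n >= t still vanishes at
    t. *)
Definition train c t := \sum_(n < (Num.truncn t).+1) c n * step (t - T n).
Definition dtrain c t := \sum_(n < (Num.truncn t).+1) c n * dstep (t - T n).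

Lemma sparse_ge n : n%:R + 1 <= T n.
Proof.
elim: n => [|n ih]; first by rewrite add0r.
by have := TS n; have : (0:R) <= n%:R := ler0n _ n; rewrite -natr1; move: ih; lra.
Qed.

Lemma sparse_ge1 n : 1 <= T n.
Proof. by apply: le_trans (sparse_ge n); rewrite lerDr. Qed.

(** Doubling from a value at least 1 leaves a gap of at least 1, so the intervals ]T n, T n + 1[ on
    which the steps rise are disjoint. *)
Lemma sparse_sep m n : (m < n)%N -> T m + 1 <= T n.
Proof.
elim: n => // n ih; rewrite ltnS leq_eqVlt => /orP[/eqP ->|/ih].
  by have := TS n; have := sparse_ge1 n; lra.
by have := TS n; have := sparse_ge1 n; lra.
Qed.

Lemma sum_ord_tail (g : nat -> R) N M : (N <= M)%N ->
  (forall n, (N <= n)%N -> g n = 0) -> \sum_(n < M) g n = \sum_(n < N) g n.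
Proof.
move=> NM g0; rewrite -!(big_mkord xpredT) (big_cat_nat (leq0n N) NM)/= [X in _ +
  X]big1_seq ?addr0//.
by move=> n /=; rewrite mem_index_iota => /andP[/g0].
Qed.

(** Both sums extend by zeros to the larger of the two ranges. A range N that stays valid on a
    neighbourhood of t is what permits termwise differentiation. *)
Lemma sum_ord_sparse c (w : R -> R) t N : (forall x, x <= 0 -> w x = 0) -> t <= N%:R ->
  \sum_(n < (Num.truncn t).+1) c n * w (t - T n) = \sum_(n < N) c n * w (t - T n).
Proof.
move=> w0 tN.
have H M : t <= M%:R -> forall n, (M <= n)%N -> c n * w (t - T n) = 0.
  move=> tM n Mn; rewrite w0 ?mulr0//.
  have := sparse_ge n; have : M%:R <= n%:R :> R by rewrite ler_nat.
  by move: tM; lra.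
have := sum_ord_tail (leq_maxl (Num.truncn t).+1 N) (H _ (ltW (truncnS_gt t))).
by rewrite (sum_ord_tail (leq_maxr (Num.truncn t).+1 N) (H _ tN)) => ->.
Qed.

Lemma trainE c t N : t <= N%:R -> train c t = \sum_(n < N) c n * step (t - T n).
Proof. by apply: sum_ord_sparse; exact: step_le0. Qed.

Lemma dtrainE c t N : t <= N%:R -> dtrain c t = \sum_(n < N) c n * dstep (t - T n).
Proof. by apply: sum_ord_sparse => x x0; rewrite dstep_eq0//; left. Qed.

Lemma is_derive_train c t : is_derive t 1 (train c) (dtrain c t).
Proof.
pose N := (Num.truncn t).+1.
have tN : t < N%:R by exact: truncnS_gt.
have D (n : 'I_N) : is_derive t 1 (fun y => c n * step (y - T n)) (c n * dstep (t - T
  n)).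
  have H := @is_derive1_comp _ (@step R) (fun y => y - T n) t _ _ (is_derive_step _)
      (is_deriveB (is_derive_id _ _) (is_derive_cst (T n) _ _)).
  by have := is_deriveZ (c n) H; rewrite subr0 mulr1.
rewrite (dtrainE c (ltW tN)).
apply: near_eq_is_derive (is_derive_sum D).
near=> y.
have yN : y <= N%:R by apply: ltW; near: y; exact: lt_nbhsl.
by rewrite (trainE c yN) fct_sumE.
Unshelve. all: by end_near. Qed.

Lemma continuous_train c : continuous (train c).
Proof.
move=> t; have [/derivable1_diffP d _] := is_derive_train c t.
exact: differentiable_continuous d.
Qed.

Lemma continuous_dtrain c : continuous (dtrain c).
Proof.
move=> t; pose N := (Num.truncn t).+1.
have tN : t < N%:R by exact: truncnS_gt.
have C : \sum_(n < N) c n * dstep (y - T n) @[y --> t] --> \sum_(n < N) c n * dstep (t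
  - T n).
  elim: N {tN} => [|N ih].
    by under eq_fun do rewrite big_ord0; rewrite big_ord0; exact: cvg_cst.
  under eq_fun do rewrite big_ord_recr/=; rewrite big_ord_recr/=.
  apply: cvgD => //; apply: cvgM; first exact: cvg_cst.
  apply: (@continuous_comp _ _ _ (fun y : R => y - T N) (@dstep R)).
    by apply: continuousB; [exact: cvg_id|exact: cvg_cst].
  exact: continuous_dstep.
rewrite /continuous_at (dtrainE c (ltW tN)).
apply: cvg_trans C; apply: near_eq_cvg; near=> y.
by rewrite (@dtrainE c y N)//; apply: ltW; near: y; exact: lt_nbhsl.
Unshelve. all: by end_near. Qed.

(** The rising intervals are disjoint, so at most one tent is nonzero at t. Its index is the same
    for all coefficients, which lets the derivatives of A and B be estimated together. *)
Lemma dtrain_spike t : (forall c, dtrain c t = 0) \/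
  exists n, [/\ T n < t, t < T n + 1 & forall c, dtrain c t = c n * dstep (t - T n)].
Proof.
pose N := (Num.truncn t).+1.
have [/existsP[n /andP[n1 n2]]|no] :=
    boolP [exists n : 'I_N, (T n < t) && (t < T n + 1)].
  right; exists n; split=> // c; rewrite /dtrain (bigD1 n)//= big1 ?addr0// => m mn.
  rewrite dstep_eq0 ?mulr0//.
  move: mn; rewrite -val_eqE /= neq_ltn => /orP[]/sparse_sep.
    by right; lra.
  by left; lra.
left=> c; rewrite /dtrain big1// => n _.
have := existsPn no n; rewrite negb_and -!leNgt => /orP H.
by rewrite dstep_eq0 ?mulr0//; case: H => ?; [left|right]; lra.
Qed.

Lemma train_eq0 c t : t <= 0 -> train c t = 0.
Proof. by move=> t0; rewrite (@trainE c t 0)// big_ord0. Qed.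

(** From T n + 1 on, the n-th step has its full height and the other steps only add to it. This
    yields the winding at the radius [rad (T n)]. *)
Lemma train_ge_coef c n t : (forall n, 0 <= c n) -> T n + 1 <= t -> c n <= train c t.
Proof.
move=> c0 nt; pose N := maxn n.+1 (Num.truncn t).+1.
have tN : t <= N%:R.
  by apply: ltW (lt_le_trans (truncnS_gt t) _); rewrite ler_nat leq_maxr.
rewrite (trainE c tN) (bigD1 (widen_ord (leq_maxl _ _) (@ord_max n)))//=.
rewrite step_ge1 ?mulr1 ?lerDl; last by lra.
apply: sumr_ge0 => m _; rewrite mulr_ge0// -(@step_le0 R 0)//.
have [?|?] := leP 0 (t - T m); first exact: step_homo.
by rewrite !step_le0// ltW.
Qed.

(** Termwise comparison of increments. Steps starting after t contribute to neither side, so M may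
    depend on t; it will be a multiple of exp (t / 2). *)
Lemma train_comparison (a b : nat -> R) (M s t : R) : s <= t ->
  (forall n, T n <= t -> b n <= M * a n) ->
  train b t - train b s <= M * (train a t - train a s).
Proof.
move=> st bM; pose N := (Num.truncn t).+1.
have tN : t <= N%:R by exact: ltW (truncnS_gt t).
rewrite !(trainE _ tN) !(trainE _ (le_trans st tN)) -!sumrB mulr_sumr.
apply: ler_sum => n _; rewrite -!mulrBr mulrA.
have [nt|tn] := leP (T n) t.
  by rewrite ler_wpM2r ?bM// subr_ge0 step_homo// lerB.
by rewrite !step_le0 ?subrr ?mulr0//; lra.
Qed.

(** Comparison with the zero train. *)
Lemma train_homo c : (forall n, 0 <= c n) -> {homo train c : s t / s <= t}.
Proof.
move=> c0 s t st; rewrite -subr_ge0.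
have := @train_comparison c (fun=> 0) 1 s t st.
rewrite mul1r [train (fun=> 0) _]big1; last by move=> *; rewrite mul0r.
rewrite [train (fun=> 0) _]big1; last by move=> *; rewrite mul0r.
by rewrite subrr; apply=> n _; rewrite mul1r.
Qed.

Lemma train_ge0 c t : (forall n, 0 <= c n) -> 0 <= train c t.
Proof.
move=> c0; rewrite -(@train_eq0 c (Num.min 0 t)) ?ge_min ?lexx//.
by apply: train_homo => //; rewrite ge_min lexx orbT.
Qed.

(** By doubling, the heights before the N-th sum to at most T N. If the N-th step is the last one
    begun before t, the total is at most 2 * T N <= 2 * t. Heights T n / 4 then give A t <= t /
    2. *)
Lemma train_sparse_le t : 0 <= t -> train T t <= 2 * t.
Proof.
move=> t0; have S N : \sum_(n < N) T n <= T N.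
  elim: N => [|N ih]; first by rewrite big_ord0 (le_trans _ T0).
  by rewrite big_ord_recr /=; have := TS N; move: ih; lra.
rewrite /train; elim: (_.+1) => [|N ih]; first by rewrite big_ord0 mulr_ge0.
rewrite big_ord_recr /=; have [tN|Nt] := leP t (T N).
  by rewrite step_le0 ?mulr0 ?addr0//; lra.
have : \sum_(n < N.+1) T n * step (t - T n) <= \sum_(n < N.+1) T n.
  apply: ler_sum => n _; rewrite -[leRHS]mulr1 ler_wpM2l//.
    by have := sparse_ge1 n; lra.
  rewrite -(@step_ge1 R (Num.max 1 (t - T n))) ?le_max ?lexx//.
  by apply: step_homo; rewrite le_max lexx orbT.
rewrite !big_ord_recr /= => /le_trans; apply; have := S N; lra.
Qed.

End Train.

(** * Spiral maps: the lower bound *)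

Section Modulus.
Variable R : realType.
Implicit Types u z w : plane R.

Definition sqmod z : R := z.1 ^+ 2 + z.2 ^+ 2.

Definition cmul u z : plane R :=
  (u.1 * z.1 - u.2 * z.2, u.1 * z.2 + u.2 * z.1).

Lemma sqmod_ge0 z : 0 <= sqmod z.
Proof. by rewrite addr_ge0// sqr_ge0. Qed.

Lemma sqmod_eq0 z : sqmod z = 0 -> z = (0, 0).
Proof.
case: z => x y /eqP; rewrite paddr_eq0 ?sqr_ge0// !sqrf_eq0 /=.
by move=> /andP[/eqP -> /eqP ->].
Qed.

Lemma sqmod_gt0 z : z != (0, 0) -> 0 < sqmod z.
Proof. by move=> /eqP z0; rewrite lt_neqAle sqmod_ge0 andbT eq_sym;
  apply/eqP => /sqmod_eq0. Qed.

Lemma sqr_modulus z : modulus z ^+ 2 = sqmod z.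
Proof. by rewrite sqr_sqrtr// sqmod_ge0. Qed.

Lemma modulus_ge0 z : 0 <= modulus z.
Proof. exact: sqrtr_ge0. Qed.

Lemma modulus_gt0 z : z != (0, 0) -> 0 < modulus z.
Proof. by move=> z0; rewrite sqrtr_gt0 sqmod_gt0. Qed.

Lemma modulus_cmul u z : modulus (cmul u z) = modulus u * modulus z.
Proof. by rewrite -sqrtrM ?sqmod_ge0//; congr Num.sqrt; rewrite /=; ring. Qed.

Lemma modulusN z : modulus (- z) = modulus z.
Proof. by congr Num.sqrt; rewrite /= !sqrrN. Qed.

Lemma le_modulus z (r : R) : 0 <= r -> (modulus z <= r) = (sqmod z <= r ^+ 2).
Proof. by move=> r0; rewrite -sqr_modulus ler_sqr ?nnegrE ?modulus_ge0. Qed.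

Lemma modulusD z w : modulus (z + w) <= modulus z + modulus w.
Proof.
rewrite le_modulus ?addr_ge0 ?modulus_ge0//.
rewrite sqrrD !sqr_modulus.
(* Cauchy-Schwarz, obtained from Lagrange's identity. *)
suff : z.1 * w.1 + z.2 * w.2 <= modulus z * modulus w.
  by rewrite /sqmod /=; lra.
rewrite -(@ger0_norm _ (modulus z * modulus w)) ?mulr_ge0 ?modulus_ge0//.
rewrite (le_trans (ler_norm _))// -ler_sqr ?nnegrE// !real_normK ?num_real//.
rewrite exprMn !sqr_modulus /sqmod.
have := sqr_ge0 (z.1 * w.2 - z.2 * w.1); lra.
Qed.

Lemma modulusB_ge z w : modulus z - modulus w <= modulus (z - w).
Proof. by rewrite lerBlDr (le_trans _ (modulusD _ _))// subrK. Qed.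

Lemma ler_norm_modulus1 z : `|z.1| <= modulus z.
Proof.
rewrite -ler_sqr ?nnegrE ?modulus_ge0// real_normK ?num_real// sqr_modulus.
by rewrite lerDl sqr_ge0.
Qed.

Lemma ler_norm_modulus2 z : `|z.2| <= modulus z.
Proof.
rewrite -ler_sqr ?nnegrE ?modulus_ge0// real_normK ?num_real// sqr_modulus.
by rewrite lerDr sqr_ge0.
Qed.

Lemma modulus_le_norm z : modulus z <= `|z.1| + `|z.2|.
Proof.
rewrite le_modulus ?addr_ge0// sqrrD !real_normK ?num_real//.
by rewrite /sqmod; have : 0 <= `|z.1| * `|z.2|
  := mulr_ge0 (normr_ge0 _) (normr_ge0 _); lra.
Qed.

Lemma lipschitz_of_derive (f df : R -> R) (L x y : R) :
  (forall t : R, is_derive t 1 f (df t)) -> (forall t, `|df t| <= L) ->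
  `|f x - f y| <= L * `|x - y|.
Proof.
move=> D H; wlog xy : x y / y <= x.
  move=> W; have [/W//|/ltW/W W1] := leP y x.
  by rewrite distrC (distrC x).
have [|c _ E] := @MVT_segment R f df y x xy.
- apply: continuous_subspaceT => z.
  have [/derivable1_diffP d _] := D z.
  exact: differentiable_continuous d.
- by rewrite E normrM ler_wpM2r.
Qed.

Lemma cos_lipschitz (x y : R) : `|cos x - cos y| <= `|x - y|.
Proof.
rewrite -[leRHS]mul1r; apply: (@lipschitz_of_derive _ (fun t => - sin t)) => t.
by rewrite normrN sin_max.
Qed.

Lemma sin_lipschitz (x y : R) : `|sin x - sin y| <= `|x - y|.
Proof.
rewrite -[leRHS]mul1r; apply: (@lipschitz_of_derive _ cos) => t.
exact: cos_max.
Qed.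

End Modulus.

Section Spiral.
Variables (R : realType) (A B : R -> R).
Implicit Types z : plane R.

(** Logarithmic depth: |z| = exp (- tau z / 2) off the origin. At the origin ln 0 = 0 gives depth 0,
    but the spiral multiplies by z and still fixes that point. *)
Definition tau z : R := - ln (sqmod z).

Definition spiral_factor (t : R) : plane R :=
  (expR (- A t) * cos (B t), expR (- A t) * sin (B t)).

Definition spiral z : plane R := cmul (spiral_factor (tau z)) z.

Lemma modulus_spiral_factor t : modulus (spiral_factor t) = expR (- A t).
Proof.
rewrite -[RHS]ger0_norm ?expR_ge0// -sqrtr_sqr; congr Num.sqrt => /=.
by rewrite !exprMn -mulrDr cos2Dsin2 mulr1.
Qed.

Lemma modulus_spiral z : modulus (spiral z) = expR (- A (tau z)) * modulus z.
Proof. by rewrite modulus_cmul modulus_spiral_factor. Qed.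

Lemma modulus_tau z : z != (0, 0) -> modulus z = expR (- (tau z / 2)).
Proof.
move=> z0; have s0 := sqmod_gt0 z0.
apply/eqP; rewrite -(@eqrXn2 _ 2) ?modulus_ge0 ?expR_ge0//; apply/eqP.
rewrite sqr_modulus expr2 -expRD /tau.
by rewrite (_ : _ + _ = ln (sqmod z)) ?lnK//; lra.
Qed.

Lemma spiral0 : spiral (0, 0) = (0, 0).
Proof. by rewrite /spiral /cmul /= !mulr0 subrr addr0. Qed.

Hypothesis A_homo : {homo A : s t / s <= t}.
Hypothesis A_eq0 : forall t, t <= 0 -> A t = 0.
Hypothesis A_le : forall t, 0 <= t -> A t <= t / 2.

Lemma spiral1 : B 0 = 0 -> spiral (1, 0) = (1, 0).
Proof.
move=> B0; rewrite /spiral /spiral_factor /cmul /tau /sqmod /= expr0n /= addr0 expr1n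
  ln1 oppr0.
by rewrite B0 A_eq0// oppr0 expR0 cos0 sin0; congr pair; ring.
Qed.

Section LowerBound.
Variable C : R.
Hypothesis C_gt0 : 0 < C.
Hypothesis B_le : forall s t, s <= t ->
  `|B t - B s| <= C * expR (t / 2) * (A t - A s).

(** The difference is a radial part of length q - q' plus q' times a chord of length at most 2 |B t
    - B s|. [B_le] bounds the angle by a multiple of A t - A s, and q' (A t - A s) <= q - q' because
    exp x >= 1 + x. *)
Lemma spiral_factor_dist s t : s <= t ->
  modulus (spiral_factor s - spiral_factor t) <=
    (1 + 2 * C * expR (t / 2)) * (expR (- A s) - expR (- A t)).
Proof.
move=> st; set q := expR (- A s); set q' := expR (- A t).
have q'0 : 0 < q' by exact: expR_gt0.
have Ast := A_homo st.
have qq' : q' <= q by rewrite ler_expR lerN2.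
have dq : q' * (A t - A s) <= q - q'.
  have -> : q = q' * expR (A t - A s) by rewrite -expRD; congr expR; lra.
  by have := expR_ge1Dx (A t - A s); nra.
have -> : spiral_factor s - spiral_factor t =
    cmul (q - q', 0) (cos (B s), sin (B s)) +
    cmul (q', 0) (cos (B s) - cos (B t), sin (B s) - sin (B t)).
  by congr pair; rewrite /= -/q -/q'; ring.
apply: le_trans (modulusD _ _) _; rewrite !modulus_cmul.
have m1 (r : R) : 0 <= r -> modulus (r, 0) = r.
  by move=> r0; rewrite /modulus /= expr0n /= addr0 sqrtr_sqr ger0_norm.
rewrite !m1 ?subr_ge0 ?expR_ge0//.
rewrite [modulus (_, sin _)]/modulus /= cos2Dsin2 sqrtr1 mulr1.
have := modulus_le_norm (cos (B s) - cos (B t), sin (B s) - sin (B t)) => /=.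
move: (modulus _) => m mle.
have := cos_lipschitz (B s) (B t); have := sin_lipschitz (B s) (B t).
move: mle; rewrite (distrC (B s)).
move: `|cos _ - _| => c1; move: `|sin _ - _| => s1.
have := B_le st; move: `|B t - B s| => b ble mle sle cle.
have h1 : q' * m <= q' * (2 * b) by rewrite ler_pM2l//; lra.
have h2 : q' * b <= C * expR (t / 2) * (q - q').
  apply: (@le_trans _ _ (q' * (C * expR (t / 2) * (A t - A s)))).
    by rewrite ler_pM2l.
  rewrite mulrCA ler_pM2l// mulr_gt0 ?expR_gt0//.
lra.
Qed.

(* |f x - f y| is at least |f x| - |f y|, and also at least q |x - y| minus the
   difference of the spiral factors times |y|; by [B_le] that difference is
   itself controlled by |f x| - |f y|. *)
Lemma spiral_lower_bound_aux x y : y != (0, 0) -> modulus y <= modulus x ->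
  expR (- A (tau x)) * modulus (x - y) * modulus x <=
    4 * (modulus x + C) * modulus (spiral x - spiral y).
Proof.
move=> y0 yx; set D := modulus (spiral x - spiral y); set d := modulus (x - y).
have r'0 : 0 < modulus y by exact: modulus_gt0.
have x0 : x != (0, 0).
  apply/eqP => x0; move: yx; rewrite leNgt x0 [X in X < _]/modulus /= expr0n addr0
    sqrtr0.
  by rewrite r'0.
have txy : tau x <= tau y.
  by move: yx; rewrite !modulus_tau// ler_expR; lra.
have Axy := A_homo txy.
set q := expR (- A (tau x)); set q' := expR (- A (tau y)).
have qq' : q' <= q by rewrite ler_expR lerN2.
have q'0 : 0 < q' by exact: expR_gt0.
have D1 : q * modulus x - q' * modulus y <= D.
  by rewrite -!modulus_spiral modulusB_ge.
have D2 : q * d <= D + modulus (spiral_factor (tau x) - spiral_factor (tau y)) *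
  modulus y.
  rewrite /q -modulus_spiral_factor -modulus_cmul -modulus_cmul.
  set u := cmul _ _; set w := cmul _ y.
  have -> : u = (spiral x - spiral y) + (- w).
    by congr pair; rewrite /= ; ring.
  by rewrite (le_trans (modulusD _ _))// modulusN.
have D3 := spiral_factor_dist txy.
have d2 : d <= 2 * modulus x.
  by rewrite (le_trans (modulusD _ _))// modulusN; lra.
(* The exponential loss in [B_le] is exactly 1 / |y|, and the factor |y| in [D2] absorbs it. *)
have ety : expR (tau y / 2) * modulus y = 1.
  by rewrite modulus_tau// -expRD subrr expR0.
move: D3; rewrite -/q -/q' => D3.
have D4 : modulus (spiral_factor (tau x) - spiral_factor (tau y)) * modulus y <=
  (modulus y + 2 * C) * (q - q').
  have := ler_wpM2r (ltW r'0) D3.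
  have -> : (1 + 2 * C * expR (tau y / 2)) * (q - q') * modulus y = (modulus y + 2 * C
    * (expR (tau y / 2) * modulus y)) * (q - q') by ring.
  by rewrite ety mulr1.
have d0 : 0 <= d by exact: modulus_ge0.
have D0 : 0 <= D by exact: modulus_ge0.
move: D1 D2 D4 d2 yx r'0 qq' q'0 d0 D0; have C0 := C_gt0; clear -C0.
move: (modulus (_ - spiral_factor _)) => e.
move: (modulus x) (modulus y) => r r' D1 D2 D4 d2 yx r'0 qq' q'0 d0 D0.
have r0 : 0 < r by lra.
have q0 : 0 < q by lra.
have D5 : q * (r - r') + r' * (q - q') <= D by move: D1; lra.
have D6 : r' * (q - q') <= D.
  have : 0 <= q * (r - r') by rewrite mulr_ge0 ?subr_ge0// ltW.
  lra.
have D7 : q * (r - r') <= D.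
  have : 0 <= r' * (q - q') by rewrite mulr_ge0 ?subr_ge0// ltW.
  lra.
(* If |x| <= 2 |y|, multiplying [D2] by |y| lets [D6] replace q - q' by D. Otherwise |x| - |y| >=
   |x| / 2, and [D7] suffices since d <= 2 |x|. *)
have [hr|hr] := leP r (2 * r').
  have D8 : r' * (q * d) <= (2 * r' + 2 * C) * D.
    have : r' * (q * d) <= r' * (D + (r' + 2 * C) * (q - q')).
      by rewrite ler_pM2l//; lra.
    have : (r' + 2 * C) * (r' * (q - q')) <= (r' + 2 * C) * D.
      by rewrite ler_pM2l//; lra.
    lra.
  have : r * (q * d) <= 2 * r' * (q * d).
    by rewrite ler_wpM2r// mulr_ge0// ltW.
  have : r' * D <= r * D by rewrite ler_wpM2r.
  lra.
have : q * (r / 2) <= D.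
  by apply: le_trans D7; rewrite ler_pM2l//; lra.
have : q * d * r <= q * (2 * r) * r by rewrite ler_pM2r// ler_pM2l.
have : 0 <= C * D by rewrite mulr_ge0// ltW.
move=> h1 h2 h3.
have : q * (r / 2) * r <= D * r by rewrite ler_pM2r.
lra.
Qed.

(** Put m = min (1, |x|). A t <= t / 2 gives exp (- A) >= m, which costs one power of m; a second
    one comes from m (|x| + C) <= |x| (1 + C). Finally |x - y| <= 2 |x| gives min (1, |x - y|) <= 2
    m. Hence the exponent 3 at small distances. *)
Lemma spiral_lower_bound x y :
  modulus (x - y) * Num.min 1 (modulus (x - y)) ^+ 2 <=
    16 * (1 + C) * modulus (spiral x - spiral y).
Proof.
wlog yx : x y / modulus y <= modulus x.
  move=> W; have [/W//|/ltW/W] := leP (modulus y) (modulus x).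
  by rewrite -modulusN opprB -(modulusN (spiral y - _)) opprB.
set D := modulus (spiral x - spiral y); set d := modulus (x - y).
have d0 : 0 <= d by exact: modulus_ge0.
have D0 : 0 <= D by exact: modulus_ge0.
have [x0|x0] := eqVneq x (0, 0).
  have y0 : y = (0, 0).
    apply: sqmod_eq0; apply/eqP; rewrite eq_le sqmod_ge0 andbT -sqr_modulus.
    by move: yx; rewrite {1}x0 [X in _ <= X]/modulus /= expr0n addr0 sqrtr0 => yx;
      have := modulus_ge0 y; nra.
  rewrite /d x0 y0 subrr [modulus 0]/modulus /= expr0n addr0 sqrtr0 mul0r.
  have C1 : 0 <= 16 * (1 + C) by have := C_gt0; lra.
  exact: mulr_ge0.
have r0 := modulus_gt0 x0.
have d2 : d <= 2 * modulus x.
  by rewrite (le_trans (modulusD _ _))// modulusN; lra.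
have qr : Num.min 1 (modulus x) <= expR (- A (tau x)).
  have [t0|t0] := leP 0 (tau x).
    rewrite ge_min modulus_tau// ler_expR lerN2 A_le// orbT//.
  by rewrite A_eq0 ?oppr0 ?expR0 ?ge_min ?lexx// ltW.
have H : expR (- A (tau x)) * d * modulus x <= 4 * (modulus x + C) * D.
  have [y0|y0] := eqVneq y (0, 0); last exact: spiral_lower_bound_aux.
  rewrite /D /d y0 spiral0 !subr0 modulus_spiral.
  have : 0 < expR (- A (tau x)) by exact: expR_gt0.
  move: (expR _) => q q0.
  have : 0 < q * modulus x by rewrite mulr_gt0.
  move: (q * _) => qr' qr'0.
  have : 0 < qr' * modulus x by rewrite mulr_gt0.
  have : 0 < C * qr' by rewrite mulr_gt0.
  lra.
move: qr H r0 d2 d0 D0; have C0 := C_gt0; clear -C0.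
move: (expR _) (modulus x) => q r qr H r0 d2 d0 D0.
set m := Num.min 1 r.
have m0 : 0 < m by rewrite lt_min ltr01.
have mr : m * (r + C) <= r * (1 + C).
  by rewrite /m; case: (leP 1 r) => h; nra.
have md : Num.min 1 d <= 2 * m.
  by rewrite /m; case: (leP 1 r); case: (leP 1 d); lra.
have md0 : 0 <= Num.min 1 d by rewrite le_min ler01.
have h1 : Num.min 1 d ^+ 2 <= 4 * m ^+ 2 by nra.
have h2 : m * d * r <= 4 * (r + C) * D.
  apply: le_trans H; rewrite ler_wpM2r ?(ltW r0)// ler_wpM2r//.
have h3 : m * (m * d * r) <= 4 * (r * (1 + C)) * D.
  apply: (@le_trans _ _ (m * (4 * (r + C) * D))); first by rewrite ler_pM2l.
  have := ler_wpM2r D0 mr; lra.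
have h4 : d * m ^+ 2 <= 4 * (1 + C) * D.
  rewrite -(ler_pM2r r0); lra.
have := ler_wpM2l d0 h1; lra.
Qed.

End LowerBound.
End Spiral.

(** * Spiral maps are homeomorphisms *)

Section SpiralHomeo.
Variables (R : realType) (A B : R -> R).
Implicit Types z w : plane R.
Hypothesis A_cont : continuous A.
Hypothesis B_cont : continuous B.

Lemma continuous_sqmod : continuous (@sqmod R).
Proof.
move=> z; apply: cvgD; under eq_fun do rewrite expr2; rewrite expr2;
  by apply: cvgM; [exact: cvg_fst|exact: cvg_fst] || apply: cvgM; exact: cvg_snd.
Qed.

Lemma continuous_tau z : z != (0, 0) -> {for z, continuous (@tau R)}.
Proof.
move=> z0; rewrite /tau; apply: continuousN.
apply: (@continuous_comp _ _ _ (@sqmod R) (@ln R)); first exact: continuous_sqmod.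
by apply: continuous_ln; exact: sqmod_gt0.
Qed.

Lemma continuous_spiral_away z : z != (0, 0) -> {for z, continuous (spiral A B)}.
Proof.
move=> z0.
have At : A (tau y) @[y --> z] --> A (tau z).
  by apply: continuous_comp; [exact: continuous_tau|exact: A_cont].
have Bt : B (tau y) @[y --> z] --> B (tau z).
  by apply: continuous_comp; [exact: continuous_tau|exact: B_cont].
have Et : expR (- A (tau y)) @[y --> z] --> expR (- A (tau z)).
  by apply: (@continuous_comp _ _ _ (fun y => - A (tau y)) expR);
    [exact: cvgN|exact: continuous_expR].
have Ct : cos (B (tau y)) @[y --> z] --> cos (B (tau z)).
  by apply: (@continuous_comp _ _ _ (fun y => B (tau y)) cos);
    [exact: Bt|exact: continuous_cos].
have St : sin (B (tau y)) @[y --> z] --> sin (B (tau z)).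
  by apply: (@continuous_comp _ _ _ (fun y => B (tau y)) sin);
    [exact: Bt|exact: continuous_sin].
have xt : y.1 @[y --> z] --> z.1 by exact: cvg_fst.
have yt : y.2 @[y --> z] --> z.2 by exact: cvg_snd.
have P1 : (spiral A B y).1 @[y --> z] --> (spiral A B z).1.
  by apply: cvgB; apply: cvgM => //; exact: cvgM.
have P2 : (spiral A B y).2 @[y --> z] --> (spiral A B z).2.
  by apply: cvgD; apply: cvgM => //; exact: cvgM.
exact: (cvg_pair P1 P2).
Qed.

Lemma norm_le_modulus z : `|z| <= modulus z.
Proof. by rewrite prod_normE ge_max ler_norm_modulus1 ler_norm_modulus2. Qed.

Lemma modulus_le_norm2 z : modulus z <= 2 * `|z|.
Proof.
apply: le_trans (modulus_le_norm z) _; rewrite mulr_natl mulr2n.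
by apply: lerD; rewrite prod_normE le_max lexx ?orbT.
Qed.

Hypothesis A_ge0 : forall t, 0 <= A t.

(** The depth is unbounded near the origin, so continuity there comes from A >= 0 instead: it gives
    |spiral w| <= |w|. *)
Lemma continuous_spiral : continuous (spiral A B).
Proof.
move=> z; have [->|] := eqVneq z (0, 0); last exact: continuous_spiral_away.
rewrite /continuous_at spiral0; apply/cvgrPdist_lt => e e0.
have d0 : 0 < e / 2 by rewrite divr_gt0.
near=> w.
rewrite [X in `|X - _|](_ : _ = 0) // sub0r normrN.
apply: le_lt_trans (norm_le_modulus _) _; rewrite modulus_spiral.
apply: (@le_lt_trans _ _ (modulus w)).
  by rewrite ler_piMl ?modulus_ge0// -expR0 ler_expR oppr_le0.
apply: le_lt_trans (modulus_le_norm2 w) _.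
rewrite -ltr_pdivlMl// mulrC -normrN -[X in `|X|]sub0r.
near: w; exact: (@cvgrPdist_lt R _ (plane R) _ _ id (0, 0)).1 (@cvg_id _ _) _ d0.
Unshelve. all: by end_near. Qed.

Hypothesis A_eq0 : forall t, t <= 0 -> A t = 0.

(** A preimage of w has depth t with t + 2 A t = tau w, which is solvable by the intermediate value
    theorem. Dividing w by the spiral factor at t then gives the preimage. *)
Lemma spiral_surj w : exists z, spiral A B z = w.
Proof.
have [->|w0] := eqVneq w (0, 0); first by exists (0, 0); exact: spiral0.
have [|||t _ Et] := @IVT R (fun t => t + 2 * A t) (Num.min (tau w) 0) (Num.max (tau w)
  0) (tau w).
- by rewrite ge_min !le_max lexx.
- apply: continuous_subspaceT => t; apply: cvgD; first exact: cvg_id.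
  by apply: cvgM; [exact: cvg_cst|exact: A_cont].
- have h1 : A (Num.min (tau w) 0) = 0 by rewrite A_eq0// ge_min lexx orbT.
  have h2 := A_ge0 (Num.max (tau w) 0).
  rewrite h1 ge_min le_max mulr0 addr0 ge_min lexx /=; apply/orP; right.
  by rewrite (@le_trans _ _ (Num.max (tau w) 0)) ?le_max ?lexx// lerDl mulr_ge0.
pose z := cmul (expR (A t) * cos (B t), - (expR (A t) * sin (B t))) w.
have Ez : sqmod z = expR (2 * A t) * sqmod w.
  rewrite -!sqr_modulus modulus_cmul exprMn; congr (_ * _).
  rewrite sqr_modulus /sqmod /= sqrrN !exprMn -mulrDr cos2Dsin2 mulr1 expr2 -expRD.
  by congr expR; ring.
have tz : tau z = t.
  rewrite /tau Ez lnM ?posrE ?expR_gt0 ?sqmod_gt0// expRK.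
  by move: Et; rewrite /tau; lra.
exists z; rewrite /spiral tz /z /spiral_factor.
have e1 : expR (- A t) * expR (A t) = 1 by rewrite mulrC expRxMexpNx_1.
have c1 := cos2Dsin2 (B t).
case: w {w0 Et z Ez tz} => w1 w2; congr pair; rewrite /=.
- transitivity (expR (- A t) * expR (A t) * (cos (B t) ^+ 2 + sin (B t) ^+ 2) * w1);
  last by rewrite e1 c1; ring.
  ring.
- transitivity (expR (- A t) * expR (A t) * (cos (B t) ^+ 2 + sin (B t) ^+ 2) * w2);
  last by rewrite e1 c1; ring.
  ring.
Qed.

(** The lower bound gives injectivity and, at the same time, a modulus of continuity for the right
    inverse chosen by surjectivity. *)
Lemma spiral_homeomorphism (c : R) : 0 < c ->
  (forall x y, modulus (x - y) * Num.min 1 (modulus (x - y)) ^+ 2 <=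
     c * modulus (spiral A B x - spiral A B y)) ->
  homeomorphism setT setT (spiral A B).
Proof.
move=> c0 H; have [g gP] := choice spiral_surj.
(* Contrapositive of [H]: when |x - y| >= e, its left side is at least min (1, e)^3. *)
have inj x y (e : R) : 0 < e ->
  modulus (spiral A B x - spiral A B y) < Num.min 1 e ^+ 3 / c ->
    modulus (x - y) < e.
  move=> e0; rewrite ltr_pdivlMr// mulrC => h; rewrite ltNge; apply/negP => ed.
  have := le_lt_trans (H x y) h; rewrite ltNge => /negP; apply.
  have m0 : 0 <= Num.min 1 e by rewrite le_min ler01 ltW.
  rewrite exprS; apply: ler_pM => //; first exact: exprn_ge0.
    by rewrite ge_min ed orbT.
  have mm : Num.min 1 e <= Num.min 1 (modulus (x - y)).
    by rewrite le_min !ge_min lexx ed orbT.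
  by apply: lerXn2r => //; rewrite nnegrE// (le_trans m0 mm).
exists g; split.
- exact: continuous_subspaceT continuous_spiral.
- apply: continuous_subspaceT => w; apply/cvgrPdist_lt => e e0.
  have d0 : 0 < Num.min 1 e ^+ 3 / c / 2.
    by rewrite !divr_gt0// exprn_gt0// lt_min ltr01.
  near=> w'.
  apply: le_lt_trans (norm_le_modulus _) _; apply: inj => //; rewrite !gP.
  apply: le_lt_trans (modulus_le_norm2 _) _.
  rewrite -ltr_pdivlMl// mulrC.
  near: w'; exact: (@cvgrPdist_lt R _ (plane R) _ _ id w).1 (@cvg_id _ _) _ d0.
- move=> x _; split=> //; apply/eqP; rewrite -subr_eq0; apply/eqP/sqmod_eq0.
  rewrite -sqr_modulus; apply/eqP; rewrite sqrf_eq0 eq_le modulus_ge0 andbT.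
  apply/ler_addgt0Pr => e e0; rewrite add0r; apply/ltW/inj => //.
  rewrite gP subrr [modulus _]/modulus /= expr0n addr0 sqrtr0.
  by rewrite divr_gt0// exprn_gt0// lt_min ltr01.
- by move=> y _; split=> //; exact: gP.
Unshelve. all: by end_near. Qed.

End SpiralHomeo.

(** * Measure theory in the plane *)

Section PlaneMeasure.
Variable R : realType.
Local Notation mu := (@lebesgue_measure R).
Local Notation mu12 := ((@lebesgue_measure R) \x (@lebesgue_measure R))%E.

(** Squares stand in for discs because their product measure is a product of interval lengths. *)
Definition square (M : R) : set (plane R) := `[- M, M] `*` `[- M, M].

Lemma in_square M (z : plane R) : square M z <-> `|z.1| <= M /\ `|z.2| <= M.
Proof. by rewrite /square /= !in_itv /= -!ler_norml. Qed.

(** Second countability: an open set is the union of the rectangles with rational endpoints that it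
    contains, and these belong to the product sigma-algebra. *)
Lemma open_plane_measurable (U : set (plane R)) :
  open U -> measurable (U : set (mplane R)).
Proof.
move=> oU.
pose I (q : (rat * rat) * (rat * rat)) : set (mplane R) :=
  `]ratr q.1.1, ratr q.1.2[ `*` `]ratr q.2.1, ratr q.2.2[.
have -> : U = \bigcup_q [set z | I q z /\ I q `<=` U].
  apply/seteqP; split => [z Uz|z [q _ [Iz /(_ _ Iz)]]//].
  have /nbhs_ballP[e /= e0 be] : nbhs z U by exact: open_nbhs_nbhs.
  have itv (x : R) : exists ab : rat * rat,
      [/\ ratr ab.1 < x, x < ratr ab.2, x - e < ratr ab.1 & ratr ab.2 < x + e].
    have xe1 : x - e < x by rewrite ltrBlDr ltrDl.
    have xe2 : x < x + e by rewrite ltrDl.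
    have [a] := rat_in_itvoo xe1; rewrite in_itv /= => /andP[a1 a2].
    have [b] := rat_in_itvoo xe2; rewrite in_itv /= => /andP[b1 b2].
    by exists (a, b).
  have [p1 [h1 h2 h3 h4]] := itv z.1; have [p2 [k1 k2 k3 k4]] := itv z.2.
  exists (p1, p2) => //; split; first by rewrite /I /= !in_itv /= h1 h2 k1 k2.
  move=> w; rewrite /I /= !in_itv /= => -[/andP[l1 l2] /andP[l3 l4]].
  apply: be; split; rewrite /ball /= ltr_distl; apply/andP; split; lra.
apply: countable_bigcupT_measurable => // q.
have [H|H] := pselect (I q `<=` U).
  rewrite (_ : [set _ | _] = I q); first exact: measurableX.
  by apply/seteqP; split => [z []|z].
rewrite (_ : [set _ | _] = set0)//.
by apply/seteqP; split => [z []|z].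
Qed.

Lemma continuous_plane_measurable (f : plane R -> R) :
  continuous f -> measurable_fun [set: mplane R] f.
Proof.
move=> /continuousP cf; apply: (measurability _ (RGenOpens.measurableE R)).
move=> _ [_ [a [b ->] <-]]; rewrite setTI; apply: open_plane_measurable.
exact/cf/interval_open.
Qed.

Lemma compact_plane_measurable (A : set (plane R)) :
  compact A -> measurable (A : set (mplane R)).
Proof.
move=> cA; rewrite -(setCK A); apply: measurableC; apply: open_plane_measurable.
by apply: closed_openC; apply: compact_closed => //; exact: norm_hausdorff.
Qed.

Lemma measurable_square M : measurable (square M : set (mplane R)).
Proof. exact: measurableX. Qed.

Lemma compact_sub_square (A : set (plane R)) : compact A ->
  exists2 M, 0 < M & A `<=` square M.
Proof.
move=> /compact_bounded[M [_ HM]]; exists (`|M| + 1); first by rewrite ltr_wpDl.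
move=> z Az; apply/in_square.
have : `|z| <= `|M| + 1.
  by apply: HM => //; rewrite (le_lt_trans (ler_norm _))// ltrDl.
by rewrite prod_normE ge_max => /andP.
Qed.

Lemma mu2_square (M : R) : 0 < M -> mu2 (square M) = (4 * M ^+ 2)%:E.
Proof.
move=> M0; rewrite /mu2 /square product_measure1E//.
pose I : set R := `[- M, M]%classic; transitivity (mu I * mu I)%E; first by [].
have -> : mu I = (2 * M)%:E.
  rewrite /I lebesgue_measure_itv /= lte_fin ifT; last by lra.
  by rewrite -EFinD; congr EFin; ring.
by rewrite -EFinM; congr EFin; ring.
Qed.

Lemma locally_integrable2_le (u : plane R -> R) (G : plane R -> \bar R) :
  measurable_fun [set: mplane R] u -> measurable_fun [set: mplane R] G ->
  (forall z, (`|u z|%:E <= G z)%E) ->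
  (forall M, 0 < M -> (\int[@mu2 R]_(z in square M) G z < +oo)%E) ->
  locally_integrable2 u.
Proof.
move=> mu_ mG uG HG A cA; have mA := compact_plane_measurable cA.
have [M M0 AM] := compact_sub_square cA.
apply/integrableP; split.
  by apply/measurable_EFinP; exact: measurable_funTS.
apply: le_lt_trans (HG M M0); rewrite /mu2.
apply: (@le_trans _ _ (\int[mu12]_(z in square M) `|(u z)%:E|)%E).
  apply: ge0_subset_integral => //; first exact: measurable_square.
  by apply: measurableT_comp => //; apply/measurable_EFinP; exact: measurable_funTS.
apply: ge0_le_integral => //; first exact: measurable_square.
- by apply: measurableT_comp => //; apply/measurable_EFinP; exact: measurable_funTS.
- exact: measurable_funTS.
- by move=> z _; exact: uG.
Qed.

Lemma locally_integrable2_cont (u : plane R -> R) :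
  continuous u -> locally_integrable2 u.
Proof.
move=> cu A cA; have mA := compact_plane_measurable cA.
have [->|/set0P A0] := eqVneq A set0; first exact: integrable_set0.
have [c _ cmax] := @compact_EVT_max _ _ (fun z => `|u z|) A A0 cA
  (continuous_subspaceT (fun z => cvg_norm (cu z))).
have [M M0 AM] := compact_sub_square cA.
have mu_ := continuous_plane_measurable cu.
apply: (@le_integrable _ _ _ _ _ mA _ (cst `|u c|%:E)).
- by apply/measurable_EFinP; exact: measurable_funTS.
- by move=> z Az; rewrite /= lee_fin normr_id; apply: cmax; rewrite inE.
apply/integrableP; split; first exact: measurable_cst.
rewrite /= normr_id integral_cst// /mu2.
apply: (@le_lt_trans _ _ (`|u c|%:E * mu12 (square M))%E).
  by apply: lee_wpmul2l => //; apply: le_measure => //; rewrite inE//;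
    exact: measurable_square.
by rewrite -/(@mu2 R) mu2_square// -EFinM ltry.
Qed.

(** Domination by max |psi| times the restriction of u to A. *)
Lemma integrable_compact_support (u psi : plane R -> R) (A : set (plane R)) :
  measurable_fun [set: mplane R] u -> locally_integrable2 u ->
  continuous psi -> compact A -> (forall z, ~ A z -> psi z = 0) ->
  mu12.-integrable [set: mplane R] (fun z => (u z * psi z)%:E).
Proof.
move=> mu_ lu cpsi cA psi0; have mA := compact_plane_measurable cA.
have mpsi := continuous_plane_measurable cpsi.
have [A0|/set0P A0] := eqVneq A set0.
  apply: (@eq_integrable _ _ _ _ _ measurableT (cst 0%E)); last exact: integrable0.
  by move=> z _; rewrite psi0 ?mulr0// A0.
have [c _ cmax] := @compact_EVT_max _ _ (fun z => `|psi z|) A A0 cA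
  (continuous_subspaceT (fun z => cvg_norm (cpsi z))).
have iu : mu12.-integrable A (fun z => (`|psi c|)%:E * (u z)%:E)%E.
  by apply: integrableZl => //; exact: lu.
move/(integrable_mkcond _ mA) : iu => iu.
apply: le_integrable iu => //.
  by apply/measurable_EFinP; exact: measurable_funM.
move=> z _; rewrite patchE; case: ifPn => [|]; rewrite ?inE ?notin_setE => Az.
  rewrite -EFinM /= lee_fin !normrM normr_id mulrC ler_wpM2r//.
  by apply: cmax; rewrite inE.
by rewrite psi0// mulr0.
Qed.

End PlaneMeasure.

(** * Weak partial derivatives *)

Section WeakPartial.
Variable R : realType.
Local Notation mu := (@lebesgue_measure R).
Local Notation mu12 := ((@lebesgue_measure R) \x (@lebesgue_measure R))%E.

(** The two difference quotients are literally the same function of h. *)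
Lemma derive_restrict_line (phi : plane R -> R) (i : R ->
  plane R) (v : plane R) (x : R) :
  (forall h, i (h *: 1 + x) = h *: v + i x) -> derivable phi (i x) v ->
  is_derive x 1 (phi \o i) ('D_v phi (i x)).
Proof.
move=> Hi dphi.
have E : (fun h : R => h^-1 *: ((phi \o i \o shift x) (h *: (1 : R)) - (phi \o i) x)) =
         (fun h => h^-1 *: ((phi \o shift (i x)) (h *: v) - phi (i x))).
  by apply/funext => h; rewrite /= Hi.
apply: DeriveDef; first by rewrite /derivable E.
by rewrite /derive E.
Qed.

Lemma test_function_derive_eq0 (phi : plane R -> R) (v z : plane R) :
  ~ closure [set w | phi w != 0] z -> 'D_v phi z = 0.
Proof.
move=> nz.
have near0 : \forall w \near z, (cst 0 : plane R -> R) w = phi w.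
  have : nbhs z (~` closure [set w | phi w != 0]).
    by apply: open_nbhs_nbhs; split=> //; apply: closed_openC; exact: closed_closure.
  apply: filterS => w nw; apply/esym/eqP/negPn/negP => w0.
  by apply: nw; exact: subset_closure.
by have [] := near_eq_is_derive near0 (is_derive_cst (0:R) z v).
Qed.

Lemma integral_derive_eq0 (F f : R -> R) (M : R) :
  (forall x : R, is_derive x 1 F (f x)) -> continuous f -> 0 < M ->
  (forall x, M <= `|x| -> F x = 0 /\ f x = 0) ->
  (\int[mu]_x (f x)%:E = 0)%E.
Proof.
move=> dF cf M0 H.
have cF : continuous F.
  by move=> x; have [/derivable1_diffP d _] := dF x; exact: differentiable_continuous d.
transitivity (\int[mu]_(x in `[(- M)%R, M]) (f x)%:E)%E.
  rewrite [RHS]integral_mkcond; apply: eq_integral => x _.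
  rewrite patchE; case: ifPn => //; rewrite notin_setE /= in_itv /= => /negP xM.
  suff Mx : M <= `|x| by have [_ ->] := H x Mx.
  by rewrite leNgt; apply: contra xM => xM; rewrite -ler_norml ltW.
rewrite (@continuous_FTC2 _ f F); first last.
- by move=> x _; rewrite derive1E; have [_ ->] := dF x.
- split.
  + by move=> x _; have [] := dF x.
  + by apply: cvg_at_right_filter; exact: cF.
  + by apply: cvg_at_left_filter; exact: cF.
- exact: continuous_subspaceT.
- lra.
by rewrite (H M _).1 ?(H (- M) _).1 ?subee// ?normrN ger0_norm// ltW.
Qed.

(** Points are null. This discards the one line through the origin in the direction of
    differentiation. *)
Lemma integral_ae_eq0_point (G : R -> \bar R) (a : R) :
  (forall y, y != a -> G y = 0%E) -> (\int[mu]_y G y = 0)%E.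
Proof.
move=> G0; rewrite -(@integral_setD1 _ G a).
- by rewrite integral0_eq// => y [_ /eqP]; exact: G0.
- exact: measurableD.
apply: (@eq_measurable_fun _ _ _ _ _ (cst 0%E)); last exact: measurable_cst.
by move=> y; rewrite inE => -[_ /eqP ya]; rewrite G0.
Qed.

(** On each line s != 0 the product u * phi is C^1 with compact support, so its derivative
    integrates to 0. Fubini applies because local integrability of u and g makes both products
    integrable on the plane. *)
Lemma weak_partial_of_classical (j : 'I_2) (u g : plane R -> R) :
  measurable_fun [set: mplane R] u -> measurable_fun [set: mplane R] g ->
  locally_integrable2 u -> locally_integrable2 g ->
  (forall s, s != 0 -> exists2 l : R -> plane R,
     (forall t, l t = if j == 0 then (t, s) else (s, t)) &
     (forall t : R, is_derive t 1 (u \o l) (g (l t))) /\ continuous (g \o l)) ->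
  weak_partial j u g.
Proof.
move=> mu_ mg lu lg H phi [Cphi cphi].
have phic : continuous phi := Cphi 0.
have [dphi dphic] := Cphi 1 j.
set S := closure _ in cphi.
have phi0 z : ~ S z -> phi z = 0.
  by move=> nS; apply/eqP/negPn/negP => z0; apply: nS; exact: subset_closure.
have Dphi0 z : ~ S z -> 'D_(basis_vec R j) phi z = 0.
  exact: test_function_derive_eq0.
have i1 := integrable_compact_support mu_ lu dphic cphi Dphi0.
have i2 := integrable_compact_support mg lg phic cphi phi0.
have [M M0 SM] := compact_sub_square cphi.
have I0 s (l : R -> plane R) : s != 0 ->
  (forall t, l t = if j == 0 then (t, s) else (s, t)) ->
  (\int[mu]_t ((u (l t) * 'D_(basis_vec R j) phi (l t))%:E + (g (l t) * phi (l t))%:E)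
    = 0)%E.
  move=> s0 lE; have [l' l'E [ul gl]] := H s s0.
  have -> : l = l' by apply/funext => t; rewrite lE l'E.
  have cl : continuous l'.
    have -> : l' = (fun t => if j == 0 then (t, s) else (s, t)) by apply/funext.
    have ct (t : R) : (fun y : R => y) x @[x --> t] --> t by exact: cvg_id.
    have cs (t : R) : (fun _ : R => s) x @[x --> t] --> s by exact: cvg_cst.
    by move=> t; case: (j == 0);
      [exact: (cvg_pair (ct t) (cs t))|exact: (cvg_pair (cs t) (ct t))].
  have dl (t : R) : is_derive t 1 (phi \o l') ('D_(basis_vec R j) phi (l' t)).
    apply: derive_restrict_line (dphi _) => h; rewrite !l'E /basis_vec.
    by case: (j == 0); congr pair; rewrite /= /GRing.scale /= ?mulr1 ?mulr0 ?add0r.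
  have cu : continuous (u \o l').
    by move=> t; have [/derivable1_diffP d _] := ul t;
      exact: differentiable_continuous d.
  (* The support lies in a closed square of half-side M, so M + 1 is strictly outside. *)
  have out t : M + 1 <= `|t| -> ~ S (l' t).
    move=> Mt /SM/in_square; rewrite l'E; case: (j == 0) => /= -[h1 h2]; lra.
  under eq_integral do rewrite -EFinD.
  apply: (@integral_derive_eq0 (fun t => u (l' t) * phi (l' t)) _ (M + 1)).
  - move=> t; have := is_deriveM (ul t) (dl t).
    by rewrite /GRing.scale /= (mulrC (phi _)).
  - move=> t; apply: cvgD; apply: cvgM.
    + exact: cu.
    + by apply: (@continuous_comp _ _ _ l' (fun z => 'D_(basis_vec R j) phi z));
      [exact: cl|exact: dphic].
    + exact: gl.
    + by apply: (@continuous_comp _ _ _ l' phi); [exact: cl|exact: phic].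
  - lra.
  - by move=> t /out nS; rewrite phi0// Dphi0// !mulr0 addr0.
suff E : (\int[mu12]_z (u z * 'D_(basis_vec R j) phi z)%:E +
          \int[mu12]_z (g z * phi z)%:E = 0)%E.
  have f1 := integrable_fin_num measurableT i1;
    have f2 := integrable_fin_num measurableT i2.
  rewrite /mu2; move: E f1 f2; move: (integral _ _ _) => a; move: (integral _ _ _) => b.
  by case: a => // a; case: b => // b /= [] E _ _; congr EFin; lra.
rewrite -integralD//.
have i12 := integrableD measurableT i1 i2.
(* The inner integral must run along the direction of differentiation, hence one order of Fubini for
   each j. *)
have [j0|j0] := eqVneq j 0.
- rewrite -(integral21_prod_meas1 i12); apply: (@integral_ae_eq0_point _ 0) => s s0.
  by apply: (I0 s (fun t => (t, s))) => // t; rewrite j0 eqxx.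
- rewrite -(integral12_prod_meas1 i12); apply: (@integral_ae_eq0_point _ 0) => s s0.
  by apply: (I0 s (fun t => (s, t))) => // t; rewrite (negbTE j0).
Qed.

End WeakPartial.

(** * The differential of a spiral map *)

Section SpiralDifferential.
Variables (R : realType) (A B dA dB : R -> R).
Implicit Types z v w : plane R.
Hypothesis A_derive : forall t : R, is_derive t 1 A (dA t).
Hypothesis B_derive : forall t : R, is_derive t 1 B (dB t).
Hypothesis dA_cont : continuous dA.
Hypothesis dB_cont : continuous dB.

Definition dot z w : R := z.1 * w.1 + z.2 * w.2.

(* [expR (tau z)] is 1 / |z|^2 off the origin. At the origin ln 0 = 0 makes it 1,
   and the formula then gives the identity. *)
Definition spiral_shear z v : plane R :=
  let c := 2 * dot z v * expR (tau z) in
  (v.1 + c * (dA (tau z) * z.1 + dB (tau z) * z.2),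
   v.2 + c * (dA (tau z) * z.2 - dB (tau z) * z.1)).

(** Df is the similarity of ratio exp (- A) and angle B applied to v + 2 <z, v> |z|^-2 (dA - i dB)
    z, so the norm and determinant estimates concern mainly the latter. *)
Definition spiral_diff z v : plane R :=
  cmul (spiral_factor A B (tau z)) (spiral_shear z v).

Definition spiral_Df z : 'M[R]_2 :=
  \matrix_(i, j) component i (spiral_diff z (basis_vec R j)).

Lemma continuous_of_derive (f df : R -> R) :
  (forall t : R, is_derive t 1 f (df t)) -> continuous f.
Proof.
by move=> D t; have [/derivable1_diffP d _] := D t; exact: differentiable_continuous d.
Qed.

Lemma expR_tau z : z != (0, 0) -> expR (tau z) = (sqmod z)^-1.
Proof. by move=> z0; rewrite /tau expRN lnK// posrE sqmod_gt0. Qed.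

Lemma is_derive_eqv (f g : R -> R) (t d e : R) :
  is_derive t 1 f d -> f =1 g -> d = e -> is_derive t 1 g e.
Proof. by move=> D /funext <- <-. Qed.

Lemma is_derive_tau_line (x y : R -> R) (t dx dy : R) :
  is_derive t 1 x dx -> is_derive t 1 y dy -> (x t, y t) != (0, 0) ->
  is_derive t 1 (fun r => tau (x r, y r))
    (- (2 * dot (x t, y t) (dx, dy) * expR (tau (x t, y t)))).
Proof.
move=> Dx Dy z0.
have Ds := is_deriveD (is_deriveM Dx Dx) (is_deriveM Dy Dy).
have s0 := sqmod_gt0 z0.
have Dl := is_derive1_ln s0.
rewrite [X in is_derive X _ _ _](_ : _ = (x * x + y * y) t) in Dl; last first.
  by rewrite /sqmod /= !expr2.
have := is_deriveN (is_derive1_comp Dl Ds).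
move/is_derive_eqv; apply.
  by move=> r; rewrite /tau /sqmod /= !expr2.
rewrite expR_tau// /dot /GRing.scale /= /sqmod /= !expr2; ring.
Qed.

(** Stated for arbitrary differentiable coordinates, so that horizontal and vertical lines are
    covered at once. *)
Lemma is_derive_spiral_line (x y : R -> R) (t dx dy : R) (i : 'I_2) :
  is_derive t 1 x dx -> is_derive t 1 y dy -> (x t, y t) != (0, 0) ->
  is_derive t 1 (fun r => component i (spiral A B (x r, y r)))
    (component i (spiral_diff (x t, y t) (dx, dy))).
Proof.
move=> Dx Dy z0; have Dt := is_derive_tau_line Dx Dy z0.
have DA := is_derive1_comp (A_derive _) Dt.
have DE := is_derive1_comp (is_derive_expR _) (is_deriveN DA).
have DB := is_derive1_comp (B_derive _) Dt.
have DC := is_derive1_comp (is_derive_cos _) DB.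
have DS := is_derive1_comp (is_derive_sin _) DB.
have D1 := is_deriveM DE DC.
have D2 := is_deriveM DE DS.
rewrite /component; case: (i == 0).
- have := is_deriveB (is_deriveM D1 Dx) (is_deriveM D2 Dy).
  move/is_derive_eqv; apply => //.
  rewrite !fctE /GRing.scale /= /spiral_shear /=.
  by move: (dot _ _) (expR (tau _)) => p q; ring.
- have := is_deriveD (is_deriveM D1 Dy) (is_deriveM D2 Dx).
  move/is_derive_eqv; apply => //.
  rewrite !fctE /GRing.scale /= /spiral_shear /=.
  by move: (dot _ _) (expR (tau _)) => p q; ring.
Qed.

Lemma continuous_spiral_diff z v i : z != (0, 0) ->
  {for z, continuous (fun z => component i (spiral_diff z v))}.
Proof.
move=> z0; have ct := continuous_tau z0.
have c (f : R -> R) : continuous f -> f (tau y) @[y --> z] --> f (tau z).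
  by move=> cf; apply: (@continuous_comp _ _ _ (@tau R) f); [exact: ct|exact: cf].
have At := c _ (continuous_of_derive A_derive).
have Bt := c _ (continuous_of_derive B_derive).
have dAt := c _ dA_cont.
have dBt := c _ dB_cont.
have et := c _ (@continuous_expR R).
have Et : expR (- A (tau y)) @[y --> z] --> expR (- A (tau z)).
  by apply: (@continuous_comp _ _ _ (fun y => - A (tau y)) expR);
    [exact: cvgN|exact: continuous_expR].
have Ct : cos (B (tau y)) @[y --> z] --> cos (B (tau z)).
  by apply: (@continuous_comp _ _ _ (fun y => B (tau y)) cos);
    [exact: Bt|exact: continuous_cos].
have St : sin (B (tau y)) @[y --> z] --> sin (B (tau z)).
  by apply: (@continuous_comp _ _ _ (fun y => B (tau y)) sin);
    [exact: Bt|exact: continuous_sin].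
have xt : y.1 @[y --> z] --> z.1 by exact: cvg_fst.
have yt : y.2 @[y --> z] --> z.2 by exact: cvg_snd.
have k (a : R) : (fun _ : plane R => a) y @[y --> z] --> a by exact: cvg_cst.
have dt : dot y v @[y --> z] --> dot z v by apply: cvgD; exact: cvgM.
have gt : 2 * dot y v * expR (tau y) @[y --> z] --> 2 * dot z v * expR (tau z).
  by apply: cvgM => //; apply: cvgM => //; exact: k.
have s1 : (spiral_shear y v).1 @[y --> z] --> (spiral_shear z v).1.
  by apply: cvgD; [exact: k|apply: cvgM => //; apply: cvgD; exact: cvgM].
have s2 : (spiral_shear y v).2 @[y --> z] --> (spiral_shear z v).2.
  by apply: cvgD; [exact: k|apply: cvgM => //; apply: cvgB; exact: cvgM].
rewrite /continuous_at /component; case: (i == 0).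
- by apply: cvgB; apply: cvgM => //; exact: cvgM.
- by apply: cvgD; apply: cvgM => //; exact: cvgM.
Qed.

Lemma measurable_sqmod : measurable_fun [set: mplane R] (@sqmod R).
Proof. exact: continuous_plane_measurable (@continuous_sqmod R). Qed.

Lemma measurable_tau : measurable_fun [set: mplane R] (@tau R).
Proof.
apply: (@measurableT_comp _ _ _ _ _ _ (@GRing.opp R)).
  by apply: continuous_measurable_fun; exact: opp_continuous.
by apply: measurableT_comp => //; exact: measurable_sqmod.
Qed.

Lemma measurable_continuous_tau (f : R -> R) : continuous f ->
  measurable_fun [set: mplane R] (fun z => f (tau z)).
Proof.
by move=> cf; apply: measurableT_comp;
  [exact: continuous_measurable_fun|exact: measurable_tau].
Qed.

(** Continuity is available only off the origin, so measurability on the whole plane is built up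
    from that of [tau]. *)
Lemma measurable_spiral_diff v i :
  measurable_fun [set: mplane R] (fun z => component i (spiral_diff z v)).
Proof.
have cA := continuous_of_derive A_derive; have cB := continuous_of_derive B_derive.
have dAt := measurable_continuous_tau dA_cont.
have dBt := measurable_continuous_tau dB_cont.
have et := measurable_continuous_tau (@continuous_expR R).
have E1 : measurable_fun [set: mplane R] (fun z => (spiral_factor A B (tau z)).1).
  apply: (@measurable_continuous_tau (fun t => expR (- A t) * cos (B t))) => t.
  apply: cvgM.
    by apply: (@continuous_comp _ _ _ (fun y => - A y) expR); [apply: cvgN;
      exact: cA|exact: continuous_expR].
  by apply: (@continuous_comp _ _ _ B cos); [exact: cB|exact: continuous_cos].
have E2 : measurable_fun [set: mplane R] (fun z => (spiral_factor A B (tau z)).2).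
  apply: (@measurable_continuous_tau (fun t => expR (- A t) * sin (B t))) => t.
  apply: cvgM.
    by apply: (@continuous_comp _ _ _ (fun y => - A y) expR); [apply: cvgN;
      exact: cA|exact: continuous_expR].
  by apply: (@continuous_comp _ _ _ B sin); [exact: cB|exact: continuous_sin].
have xt : measurable_fun [set: mplane R] (fun z : mplane R => z.1) by exact:
  measurable_fst.
have yt : measurable_fun [set: mplane R] (fun z : mplane R => z.2) by exact:
  measurable_snd.
have k (a : R) : measurable_fun [set: mplane R] (fun _ : mplane R => a) by exact:
  measurable_cst.
have dt : measurable_fun [set: mplane R] (fun z => dot z v).
  by apply: measurable_funD; apply: measurable_funM.
have gt : measurable_fun [set: mplane R] (fun z => 2 * dot z v * expR (tau z)).
  by apply: measurable_funM => //; apply: measurable_funM.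
have s1 : measurable_fun [set: mplane R] (fun z => (spiral_shear z v).1).
  by apply: measurable_funD => //; apply: measurable_funM => //;
    apply: measurable_funD; apply: measurable_funM.
have s2 : measurable_fun [set: mplane R] (fun z => (spiral_shear z v).2).
  by apply: measurable_funD => //; apply: measurable_funM => //;
    apply: measurable_funB; apply: measurable_funM.
rewrite /component; case: (i == 0).
- by apply: measurable_funB; apply: measurable_funM.
- by apply: measurable_funD; apply: measurable_funM.
Qed.

End SpiralDifferential.

(** * Operator norm, Jacobian and distortion of a spiral *)

Section SpiralDistortion.
Variables (R : realType) (A B dA dB : R -> R).
Implicit Types z v w : plane R.
Hypothesis A_derive : forall t : R, is_derive t 1 A (dA t).
Hypothesis B_derive : forall t : R, is_derive t 1 B (dB t).
Hypothesis dA_cont : continuous dA.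
Hypothesis dB_cont : continuous dB.
Hypothesis A_ge0 : forall t, 0 <= A t.
Hypothesis dA_ge0 : forall t, 0 <= dA t.

(* |Df|^2 <= e^(-2A) (4 dA^2 + 4 dA + 3 + 8 dB^2) and J = e^(-2A) (1 + 2 dA). *)
Definition distortion (t : R) : R :=
  (4 * dA t ^+ 2 + 4 * dA t + 3 + 8 * dB t ^+ 2) / (1 + 2 * dA t).

Lemma distortion_den t : distortion t * (1 + 2 * dA t) =
  4 * dA t ^+ 2 + 4 * dA t + 3 + 8 * dB t ^+ 2.
Proof. by rewrite mulfVK// gt_eqF// ltr_wpDr// mulr_ge0. Qed.

(** The numerator exceeds the square of the denominator by 2 + 8 dB^2. *)
Lemma distortion_ge t : 1 + 2 * dA t <= distortion t.
Proof.
have a0 := dA_ge0 t; have a1 : 0 < 1 + 2 * dA t by lra.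
rewrite ler_pdivlMr//; have := sqr_ge0 (dB t); lra.
Qed.

Lemma continuous_distortion : continuous distortion.
Proof.
move=> t.
have k (a : R) : (fun _ : R => a) y @[y --> t] --> a by exact: cvg_cst.
have ca : dA y @[y --> t] --> dA t by exact: dA_cont.
have cb : dB y @[y --> t] --> dB t by exact: dB_cont.
rewrite /distortion /continuous_at; under eq_fun do rewrite !expr2.
rewrite !expr2; apply: cvgM.
  by apply: cvgD; [apply: cvgD => //; apply: cvgD; apply: cvgM => //; exact: cvgM|
    apply: cvgM => //; exact: cvgM].
apply: cvgV; first by have := dA_ge0 t; lra.
by apply: cvgD => //; exact: cvgM.
Qed.

Lemma expR_tau_sqmod z : expR (tau z) * sqmod z = 1 \/ z = (0, 0).
Proof.
have [->|z0] := eqVneq z (0, 0); [by right|left].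
by rewrite expR_tau// mulVf// gt_eqF// sqmod_gt0.
Qed.

(** Off the origin, with P and N the radial and tangential products of z and v, |v|^2 = e P^2 + e
    N^2 where e = |z|^-2. The only cross term, - 4 b e P N, is at most 4 b^2 e P^2 + e N^2 by
    completing the square; this doubles the coefficient of b^2 to 8. *)
Lemma sqmod_spiral_shear_le z v : sqmod (spiral_shear dA dB z v) <=
  distortion (tau z) * (1 + 2 * dA (tau z)) * sqmod v.
Proof.
rewrite distortion_den /sqmod /spiral_shear /=.
have := dA_ge0 (tau z); have := expR_tau_sqmod z; have := expR_ge0 (tau z).
move: (expR _) (dA _) (dB _) => e a b e0 es a0.
case: z v es => x y [v1 v2]; rewrite /dot /sqmod /= => es.
set P := x * v1 + y * v2; pose N := x * v2 - y * v1.
have {es} [es|[-> ->]] := es; last first.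
  have -> : v1 + 2 * P * e * (a * 0 + b * 0) = v1 by ring.
  have -> : v2 + 2 * P * e * (a * 0 - b * 0) = v2 by ring.
  have h1 : 0 <= v1 ^+ 2 + v2 ^+ 2 by rewrite addr_ge0 ?sqr_ge0.
  have h2 := mulr_ge0 a0 h1; have h3 := mulr_ge0 (sqr_ge0 a) h1.
  have h4 := mulr_ge0 (sqr_ge0 b) h1; lra.
have EV : e * P ^+ 2 + e * N ^+ 2 = v1 ^+ 2 + v2 ^+ 2.
  transitivity (e * (x ^+ 2 + y ^+ 2) * (v1 ^+ 2 + v2 ^+ 2)); first by rewrite /P /N;
    ring.
  by rewrite es mul1r.
have -> : (v1 + 2 * P * e * (a * x + b * y)) ^+ 2 + (v2 + 2 * P * e * (a * y - b * x))
  ^+ 2 =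
    v1 ^+ 2 + v2 ^+ 2 + 4 * a * (e * P ^+ 2) - 4 * b * e * P * N
    + 4 * (a ^+ 2 + b ^+ 2) * (e * P ^+ 2) * (e * (x ^+ 2 + y ^+ 2)).
  by rewrite /P /N; ring.
rewrite es mulr1.
have h1 : 0 <= e * (2 * b * P + N) ^+ 2 by rewrite mulr_ge0// sqr_ge0.
have p0 : 0 <= e * P ^+ 2 by rewrite mulr_ge0// sqr_ge0.
have n0 : 0 <= e * N ^+ 2 by rewrite mulr_ge0// sqr_ge0.
have h2 : - (4 * b * e * P * N) <= 4 * b ^+ 2 * (e * P ^+ 2) + e * N ^+ 2.
  have -> : 4 * b ^+ 2 * (e * P ^+ 2) + e * N ^+ 2 =
     e * (2 * b * P + N) ^+ 2 - 4 * b * e * P * N by ring.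
  lra.
rewrite -EV; clear EV h1 es.
move: h2 p0 n0; move: (4 * b * e * P * N) (e * P ^+ 2) (e * N ^+ 2) => u p n h2 p0 n0.
have h3 := mulr_ge0 (sqr_ge0 b) n0; have h4 := mulr_ge0 (sqr_ge0 a) n0.
have h5 := mulr_ge0 a0 n0.
have h6 := mulr_ge0 (sqr_ge0 b) p0; have h7 := mulr_ge0 (sqr_ge0 a) p0.
lra.
Qed.

Lemma spiral_Df_mul z (v : 'cV[R]_2) :
  enorm (spiral_Df A B dA dB z *m v) = modulus (spiral_diff A B dA dB z (v 0 0, v 1 0)).
Proof.
have L : lift ord0 ord0 = 1 :> 'I_2 by exact/val_inj.
congr Num.sqrt; rewrite big_ord_recl big_ord1 L !mxE !big_ord_recl !big_ord0 !addr0 L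
  !mxE.
by rewrite /component /= /spiral_shear /dot /basis_vec /=; congr (_ + _);
  congr (_ ^+ 2); ring.
Qed.

(** The shear is a rank-one perturbation of the identity whose trace involves only dA. The factor
    [expR (tau z) * sqmod z] is 1 off the origin and 0 at it, so the formula holds everywhere. *)
Lemma det_spiral_Df z : \det (spiral_Df A B dA dB z) =
  expR (- A (tau z)) ^+ 2 * (1 + 2 * dA (tau z) * (expR (tau z) * sqmod z)).
Proof.
have L : lift ord0 ord0 = 1 :> 'I_2 by exact/val_inj.
have L1 : lift 1 0 = 0 :> 'I_2 by exact/val_inj.
have L2 : lift 0 0 = 1 :> 'I_2 by exact/val_inj.
have L3 : lift ord0 0 = 1 :> 'I_2 by exact/val_inj.
rewrite (expand_det_row _ 0) !big_ord_recl big_ord0 /cofactor !det_mx11 !mxE ?L ?L3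
  ?L2 ?L1.
rewrite addr0 expr0 expr1 mul1r mulN1r mulrN.
rewrite /component /= /spiral_shear /dot /sqmod /basis_vec /= !mulr0 !mulr1 !addr0
  !add0r.
have := cos2Dsin2 (B (tau z)).
move: (expR (- _)) (cos _) (sin _) (expR _) (dA _) (dB _) z.1 z.2 => q c s e a b x y cs.
transitivity (e ^+ 2 * (c ^+ 2 + s ^+ 2) * (1 + 2 * a * (q * (x ^+ 2 + y ^+ 2))));
  last by rewrite cs mulr1.
ring.
Qed.

(** With K the distortion and exp (- A) <= 1, |Df|^2 <= K (1 + 2 dA) <= K^2. Integrability of K will
    therefore make Df locally integrable. *)
Lemma spiral_Df_entry_le z i j : `|spiral_Df A B dA dB z i j| <= distortion (tau z).
Proof.
have K1 := distortion_ge (tau z); have a0 := dA_ge0 (tau z).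
have K0 : 0 <= distortion (tau z) by lra.
rewrite mxE; apply: (@le_trans _ _ (modulus (spiral_diff A B dA dB z (basis_vec R j)))).
  by rewrite /component; case: (i == 0);
    [exact: ler_norm_modulus1|exact: ler_norm_modulus2].
rewrite modulus_cmul modulus_spiral_factor.
apply: (@le_trans _ _ (modulus (spiral_shear dA dB z (basis_vec R j)))).
  by rewrite ler_piMl ?modulus_ge0// -expR0 ler_expR oppr_le0.
rewrite le_modulus// (le_trans (sqmod_spiral_shear_le _ _))//.
have -> : sqmod (basis_vec R j) = 1.
  by rewrite /basis_vec /sqmod; case: (j == 0); rewrite /= !expr2; ring.
by rewrite mulr1 expr2 ler_wpM2l.
Qed.

Lemma expR_tau_sqmod_le z : 0 <= expR (tau z) * sqmod z <= 1.
Proof.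
rewrite mulr_ge0 ?expR_ge0 ?sqmod_ge0//=.
by have [->//|->] := expR_tau_sqmod z; rewrite /sqmod /= expr0n /= addr0 mulr0.
Qed.

Lemma det_spiral_Df_le z : `|\det (spiral_Df A B dA dB z)| <= distortion (tau z).
Proof.
have /andP[s0 s1] := expR_tau_sqmod_le z.
have a0 := dA_ge0 (tau z).
have J0 : 0 <= 1 + 2 * dA (tau z) * (expR (tau z) * sqmod z).
  by rewrite addr_ge0// !mulr_ge0// ?expR_ge0 ?sqmod_ge0.
rewrite det_spiral_Df ger0_norm; last by rewrite mulr_ge0// sqr_ge0.
apply: le_trans (distortion_ge _).
apply: (@le_trans _ _ (1 + 2 * dA (tau z) * (expR (tau z) * sqmod z))).
  by rewrite ler_piMl// expr_le1// ?expR_ge0// -expR0 ler_expR oppr_le0.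
by rewrite lerD2l ler_piMr// mulr_ge0.
Qed.

Lemma opnorm_spiral_Df_le z :
  opnorm (spiral_Df A B dA dB z) ^+ 2 <= distortion (tau z) * \det (spiral_Df A B dA
    dB z).
Proof.
set S := [set enorm (spiral_Df A B dA dB z *m v) | v in [set v : 'cV[R]_2 |
  enorm v <= 1]].
have a0 := dA_ge0 (tau z).
have K1 := distortion_ge (tau z).
have K0 : 0 <= distortion (tau z) by lra.
set Q := distortion (tau z) * \det (spiral_Df A B dA dB z).
have Sub (v : 'cV[R]_2) : enorm v <= 1 -> enorm (spiral_Df A B dA dB z *m v) ^+ 2 <= Q.
  move=> v1; rewrite spiral_Df_mul sqr_modulus -sqr_modulus modulus_cmul
    modulus_spiral_factor exprMn sqr_modulus.
  rewrite /Q det_spiral_Df mulrCA; apply: ler_wpM2l; first exact: sqr_ge0.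
  have V1 : sqmod (v 0 0, v 1 0) <= 1.
    have L : lift ord0 ord0 = 1 :> 'I_2 by exact/val_inj.
    rewrite -sqr_modulus expr_le1 ?modulus_ge0//; move: v1.
    by rewrite /enorm big_ord_recl big_ord1 L.
  (* At the origin the determinant loses its term in dA, but there the shear is the identity and the
     distortion is at least 1. *)
  have [es|z0] := expR_tau_sqmod z.
    rewrite es mulr1 (le_trans (sqmod_spiral_shear_le _ _))//.
    rewrite -[leRHS]mulr1 ler_wpM2l// mulr_ge0//; lra.
  rewrite z0 [X in _ * (_ + _ * (_ * X))]/sqmod /= expr0n /= addr0 !mulr0 addr0 mulr1.
  have -> : spiral_shear dA dB (0, 0) (v 0 0, v 1 0) = (v 0 0, v 1 0).
    by rewrite /spiral_shear /dot /=; congr pair; ring.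
  by rewrite (le_trans V1)// -z0; lra.
have Q0 : 0 <= Q.
  by apply: le_trans (Sub 0 _); rewrite ?sqr_ge0// /enorm big1 ?sqrtr0// => i _;
    rewrite mxE expr0n.
have ub : ubound S (Num.sqrt Q).
  move=> _ [v /= v1 <-]; have e0 : 0 <= enorm (spiral_Df A B dA dB z *m v) by exact:
    sqrtr_ge0.
  by rewrite -ler_sqr ?nnegrE ?sqrtr_ge0// (sqr_sqrtr Q0); exact: Sub.
have S0 : S (enorm (spiral_Df A B dA dB z *m 0)).
  by exists 0 => //=; rewrite /enorm big1 ?sqrtr0// => i _; rewrite mxE expr0n.
have le1 : opnorm (spiral_Df A B dA dB z) <= Num.sqrt Q.
  by apply: ge_sup => //; exists (enorm (spiral_Df A B dA dB z *m 0)).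
have ge0 : 0 <= opnorm (spiral_Df A B dA dB z).
  apply: (@le_trans _ _ (enorm (spiral_Df A B dA dB z *m 0))); first exact: sqrtr_ge0.
  by apply: sup_upper_bound => //; split;
    [exists (enorm (spiral_Df A B dA dB z *m 0))|exists (Num.sqrt Q)].
by rewrite -(sqr_sqrtr Q0) ler_sqr// nnegrE sqrtr_ge0.
Qed.

End SpiralDistortion.

(** * An integrable majorant built from squares *)

Section SquareSeries.
Variables (R : realType) (c0 : R) (c r : nat -> R).
Local Notation mu12 := ((@lebesgue_measure R) \x (@lebesgue_measure R))%E.

(** Meant to dominate the p-th power of the distortion: c0 away from the steps, and c n on a square
    containing the n-th annulus. *)
Definition square_series (z : plane R) : \bar R :=
  (c0%:E + \sum_(0 <= n <oo) (c n * \1_(square (r n)) z)%:E)%E.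

Hypothesis c0_ge0 : 0 <= c0.
Hypothesis c_ge0 : forall n, 0 <= c n.
Hypothesis r_gt0 : forall n, 0 < r n.
Hypothesis cr_le : forall n, 4 * (c n * r n ^+ 2) <= 1 / (2 ^ n.+1)%:R.

Let term_ge0 n z : (0 <= (c n * \1_(square (r n)) z)%:E)%E.
Proof. by rewrite lee_fin mulr_ge0. Qed.

Lemma square_series_ge0 z : (c0%:E <= square_series z)%E.
Proof. by rewrite leeDl// nneseries_ge0. Qed.

Lemma square_series_ge_coef n z : square (r n) z -> ((c n)%:E <= square_series z)%E.
Proof.
move=> nz; rewrite /square_series (@nneseriesD1 _ _ n)// indicE mem_set// mulr1.
by rewrite addeCA leeDl// adde_ge0 ?lee_fin// nneseries_ge0.
Qed.

Let measurable_term n : measurable_fun [set: mplane R] (fun z => (c n * \1_(square (r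
  n)) z)%:E).
Proof.
apply/measurable_EFinP; apply: measurable_funM; first exact: measurable_cst.
by apply: measurable_indic; exact: measurable_square.
Qed.

Let measurable_tail : measurable_fun [set: mplane R]
  (fun z => (\sum_(0 <= n <oo) (c n * \1_(square (r n)) z)%:E)%E).
Proof. exact: (@ge0_emeasurable_sum _ _ _ _ _ xpredT). Qed.

Lemma measurable_square_series : measurable_fun [set: mplane R] square_series.
Proof. by apply: emeasurable_funD => //; exact: measurable_cst. Qed.

(** The n-th term integrates to at most c n times the area 4 r_n^2 of its square, and [cr_le] makes
    these bounds a geometric series. *)
Lemma integral_square_series_lty (M : R) : 0 < M ->
  (\int[@mu2 R]_(z in square M) square_series z < +oo)%E.
Proof.
move=> M0; rewrite /mu2; have mM := measurable_square M.
rewrite ge0_integralD//; first last.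
- exact: measurable_funTS.
- by move=> z _; exact: nneseries_ge0.
rewrite integral_cst// [X in (_ * X + _)%E](mu2_square M0) -EFinM.
rewrite lte_add_pinfty ?ltry// /mu2 integral_nneseries//; last first.
  by move=> n; exact: measurable_funTS.
apply: (@le_lt_trans _ _ 1%E); last exact: ltry.
apply: le_trans (@epsilon_trick0 R 1 xpredT ler01).
apply: lee_nneseries => n; first by move=> _ _; apply: integral_ge0 => z _;
  exact: term_ge0.
move=> _; apply: le_trans (_ : (4 * (c n * r n ^+ 2))%:E <= _)%E;
  last by rewrite lee_fin.
under eq_integral do rewrite EFinM.
have mn := measurable_square (r n).
rewrite ge0_integralZl//; first last.
- by rewrite lee_fin.
- by apply: measurable_funTS; apply/measurable_EFinP; exact: measurable_indic.
rewrite integral_indic//.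
apply: (@le_trans _ _ ((c n)%:E * mu12 (square (r n)))%E).
  by rewrite lee_wpmul2l ?lee_fin// le_measure ?inE//; exact: measurableI.
by rewrite [X in (_ * X)%E](mu2_square (r_gt0 n)) -EFinM lee_fin; lra.
Qed.

End SquareSeries.

(** * Finite distortion and local p-integrability *)

Section SpiralFiniteDistortion.
Variables (R : realType) (A B dA dB : R -> R) (p : R) (G : plane R -> \bar R).
Hypothesis A_derive : forall t : R, is_derive t 1 A (dA t).
Hypothesis B_derive : forall t : R, is_derive t 1 B (dB t).
Hypothesis dA_cont : continuous dA.
Hypothesis dB_cont : continuous dB.
Hypothesis A_ge0 : forall t, 0 <= A t.
Hypothesis dA_ge0 : forall t, 0 <= dA t.
Hypothesis p_ge1 : 1 <= p.
Hypothesis G_meas : measurable_fun [set: mplane R] G.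
Hypothesis G_int : forall M, 0 < M -> (\int[@mu2 R]_(z in square M) G z < +oo)%E.
Hypothesis G_ge : forall z, ((distortion dA dB (tau z) `^ p)%:E <= G z)%E.

Let K t := distortion dA dB t.

Let K_ge1 t : 1 <= K t.
Proof. by apply: le_trans (distortion_ge _ dA_ge0 t); rewrite lerDl mulr_ge0. Qed.

(** K >= 1 and p >= 1 give K <= K^p <= G. *)
Let bounded_integrable (u : plane R -> R) :
  measurable_fun [set: mplane R] u -> (forall z, `|u z| <= K (tau z)) ->
  locally_integrable2 u.
Proof.
move=> mu_ uK; apply: (locally_integrable2_le mu_ G_meas) => // z.
apply: le_trans (G_ge z); rewrite lee_fin (le_trans (uK z))//.
exact: le1r_powR.
Qed.

Lemma spiral_finite_distortion : exists k : plane R -> \bar R,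
  finite_distortion (spiral A B) k /\ Lp_loc p k.
Proof.
have mK : measurable_fun [set: mplane R] (fun z => (K (tau z))%:E).
  apply/measurable_EFinP; apply: measurable_continuous_tau.
  exact: continuous_distortion.
have cS := continuous_spiral (continuous_of_derive A_derive) (continuous_of_derive
  B_derive) A_ge0.
have cSi i : continuous (fun z => component i (spiral A B z)).
  move=> z; rewrite /component; case: (i == 0).
    by apply: (@continuous_comp _ _ _ (spiral A B) fst); [exact: cS|exact: cvg_fst].
  by apply: (@continuous_comp _ _ _ (spiral A B) snd); [exact: cS|exact: cvg_snd].
have mD i j : measurable_fun [set: mplane R] (fun z => spiral_Df A B dA dB z i j).
  have -> : (fun z => spiral_Df A B dA dB z i j) =
      (fun z => component i (spiral_diff A B dA dB z (basis_vec R j))).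
    by apply/funext => z; rewrite mxE.
  exact: measurable_spiral_diff.
have mJ : measurable_fun [set: mplane R] (fun z => \det (spiral_Df A B dA dB z)).
  have -> : (fun z => \det (spiral_Df A B dA dB z)) =
      (fun z => expR (- A (tau z)) ^+ 2 * (1 + 2 * dA (tau z) * (expR (tau z) * sqmod
        z))).
    by apply/funext => z; rewrite det_spiral_Df.
  have cE : continuous (fun t => expR (- A t) ^+ 2).
    under eq_fun do rewrite expr2.
    move=> t.
    have c1 : expR (- A y) @[y --> t] --> expR (- A t).
      apply: (@continuous_comp _ _ _ (fun y => - A y) expR);
        last exact: continuous_expR.
      by apply: cvgN; exact: (continuous_of_derive A_derive).
    exact: (cvgM c1 c1).
  apply: measurable_funM; first exact: (measurable_continuous_tau cE).
  apply: measurable_funD; first exact: measurable_cst.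
  apply: measurable_funM.
    by apply: measurable_funM; [exact: measurable_cst|exact: measurable_continuous_tau].
  apply: measurable_funM; first exact: (measurable_continuous_tau (@continuous_expR R)).
  exact: measurable_sqmod.
exists (fun z => (K (tau z))%:E); split.
- exists (spiral_Df A B dA dB); split.
  + split=> [i|i j]; first exact: locally_integrable2_cont.
    have lD : locally_integrable2 (fun z => spiral_Df A B dA dB z i j).
      by apply: bounded_integrable => // z; exact: spiral_Df_entry_le.
    split=> //; apply: weak_partial_of_classical => //.
    * exact: continuous_plane_measurable.
    * exact: locally_integrable2_cont.
    (* A line with s != 0 misses the origin, so the classical derivative is available and continuous
       along it. *)
    move=> s s0; exists (fun t => if j == 0 then (t, s) else (s, t)) => //.
    have nz t : (if j == 0 then (t, s) else (s, t)) != (0, 0).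
      by case: (j == 0); rewrite xpair_eqE (negbTE s0) ?andbF.
    have did t := is_derive_id (t : R) (1 : R);
      have dcst t := is_derive_cst s (t : R) (1 : R).
    split=> t.
    * rewrite mxE /basis_vec; move: (nz t).
      case: (j == 0) => nzt.
        exact: (is_derive_spiral_line A_derive B_derive i (did t) (dcst t) nzt).
      exact: (is_derive_spiral_line A_derive B_derive i (dcst t) (did t) nzt).
    * apply: (@continuous_comp _ _ _ (fun t => if j == 0 then (t, s) else (s, t))
         (fun z => spiral_Df A B dA dB z i j)).
        have ct : (fun y : R => y) x @[x --> t] --> t by exact: cvg_id.
        have cs : (fun _ : R => s) x @[x --> t] --> s by exact: cvg_cst.
        by case: (j == 0); [exact: (cvg_pair ct cs)|exact: (cvg_pair cs ct)].
      have -> : (fun z => spiral_Df A B dA dB z i j) =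
        (fun z => component i (spiral_diff A B dA dB z (basis_vec R j))).
        by apply/funext => z; rewrite mxE.
      exact: continuous_spiral_diff.
  + by apply: bounded_integrable => // z; exact: det_spiral_Df_le.
  + exact: mK.
  + by move=> z; rewrite lee_fin.
  + by apply: aeW => z; rewrite -EFinM lee_fin; exact: opnorm_spiral_Df_le.
split=> // S cS'.
have [M M0 SM] := compact_sub_square cS'.
apply: le_lt_trans (G_int M0); rewrite /mu2.
have mS := compact_plane_measurable cS'; have mM := measurable_square M.
have mKp : measurable_fun [set: mplane R] (fun z => (`|(K (tau z))%:E| `^ p)%E).
  have -> : (fun z : mplane R => (`|(K (tau z))%:E|
    `^ p)%E) = (fun z => (K (tau z) `^ p)%:E).
    by apply/funext => z; rewrite /= ger0_norm ?(le_trans _ (K_ge1 _)).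
  apply/measurable_EFinP; apply: (measurableT_comp (measurable_powR p)).
  by apply: measurable_continuous_tau; exact: continuous_distortion.
apply: (@le_trans _ _ (\int[(@lebesgue_measure R) \x (@lebesgue_measure R)]_(z in
  square M) (`|(K (tau z))%:E| `^ p))%E).
  apply: ge0_subset_integral => //; first exact: measurable_funTS.
  by move=> z _; exact: poweR_ge0.
apply: ge0_le_integral => //.
- by move=> z _; exact: poweR_ge0.
- exact: measurable_funTS.
- exact: measurable_funTS.
- by move=> z _; rewrite /= ger0_norm ?(le_trans _ (K_ge1 _)).
Qed.

End SpiralFiniteDistortion.

(** * Choice of the scales *)

Section SparseScales.
Variables (R : realType) (h : R -> R) (p : R).
Hypothesis p_gt1 : 1 < p.
Hypothesis h_ge0 : forall x, 0 <= x -> 0 <= h x.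
Hypothesis h_incr : forall x y, 0 <= x -> x < y -> h x < h y.
Hypothesis h_small : forall e, 0 < e -> exists2 x, 0 < x & h x = e.

(** The radius at depth t + 1, where the step starting at t is complete. *)
Definition rad (t : R) : R := expR (- ((t + 1) / 2)).

Definition target (r : R) : R := r `^ (- p^-1) * ln r^-1 `^ 2^-1 * h r.

(** The bound 3 + 4 a + 8 b^2 / a of [distortion_spike_le] for a = t / 4 and b =
    [target (rad t)]. *)
Definition weight (t : R) : R := 3 + t + 32 * target (rad t) ^+ 2 / t.

Lemma rad_gt0 t : 0 < rad t. Proof. exact: expR_gt0. Qed.

Lemma target_ge0 t : 0 <= target (rad t).
Proof. by rewrite /target !mulr_ge0 ?powR_ge0// h_ge0// ltW// rad_gt0. Qed.

Lemma rad_le1 t : 0 <= t -> rad t <= 1.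
Proof. by move=> t0; rewrite -expR0 ler_expR; lra. Qed.

Lemma targetE t : target (rad t) =
  expR ((t + 1) / 2 / p) * ((t + 1) / 2) `^ 2^-1 * h (rad t).
Proof.
rewrite /target /rad -expRM -expRN opprK expRK; congr (expR _ * _ * _).
by rewrite mulrNN.
Qed.

Lemma sqrt_powR (x : R) : 0 <= x -> (x `^ 2^-1) ^+ 2 = x.
Proof. by move=> x0; rewrite powR12_sqrt// sqr_sqrtr. Qed.

Lemma sqr_target t : 1 <= t -> target (rad t) ^+ 2 =
  expR ((t + 1) / p) * ((t + 1) / 2) * h (rad t) ^+ 2.
Proof.
move=> t1; rewrite targetE !exprMn sqrt_powR; last by lra.
congr (_ * _ * _); rewrite expr2 -expRD; congr expR; field.
by have := p_gt1; lra.
Qed.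

(** With r = [rad t]: p > 1 gives r^(-1/p) <= 1 / r, the root of the logarithm is at most t, and h r
    <= h 1. This is the ratio of rotation to compression asked for by [B_le]; the 4 undoes a = t /
    4, and the 1 makes the constant positive. *)
Lemma target_le t : 1 <= t ->
  target (rad t) <= (4 * expR 2^-1 * h 1 + 1) * expR (t / 2) * (t / 4).
Proof.
move=> t1; rewrite targetE; have p1 := p_gt1.
have L1 : 1 <= (t + 1) / 2 by lra.
have e1 : expR ((t + 1) / 2 / p) <= expR 2^-1 * expR (t / 2).
  rewrite -expRD ler_expR ler_pdivrMr; last by lra.
  by have : (2^-1 + t / 2) * 1 <= (2^-1 + t / 2) * p; [rewrite ler_wpM2l; lra|lra].
have e2 : ((t + 1) / 2) `^ 2^-1 <= t.
  by apply: le_trans (ler1_powR L1 _) _; lra.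
have e3 : h (rad t) <= h 1.
  have : rad t <= 1 by apply: rad_le1; lra.
  rewrite le_eqVlt => /orP[/eqP->//|r1].
  by apply/ltW/h_incr => //; exact/ltW/rad_gt0.
have h0 := h_ge0 (ltW (rad_gt0 t)).
apply: (@le_trans _ _ (expR 2^-1 * expR (t / 2) * t * h 1)).
  by apply: ler_pM => //; [rewrite mulr_ge0 ?expR_ge0 ?powR_ge0|apply: ler_pM;
    rewrite ?expR_ge0 ?powR_ge0].
have : 0 <= expR (t / 2) * t by rewrite mulr_ge0 ?expR_ge0//; lra.
lra.
Qed.

Lemma expR_ge_sqr (x : R) : 0 <= x -> x ^+ 2 / 4 <= expR x.
Proof.
move=> x0; rewrite (_ : x = x / 2 + x / 2); last by lra.
rewrite expRD; have := expR_ge1Dx (x / 2); nra.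
Qed.

(** In the square of the target the exponential cancels exp (- t / p) up to exp (1 / p), and the
    logarithm cancels 1 / t up to a constant. What remains is a multiple of h (rad t)^2, which is
    small because h takes arbitrarily small values. The part (3 + t) exp (- t / p) decays by
    itself. *)
Lemma weight_small e : 0 < e -> exists t0, forall t, t0 <= t ->
  weight t * expR (- (t / p)) <= e.
Proof.
move=> e0; have p1 := p_gt1.
(* Chosen so that 32 exp (1 / p) * (e / c) = e / 2. *)
set c := 64 * expR p^-1.
have c0 : 0 < c by rewrite mulr_gt0 ?expR_gt0.
set eta := Num.min 1 (e / c).
have eta0 : 0 < eta by rewrite lt_min ltr01 divr_gt0.
have [x x0 hx] := h_small eta0.
(* The three thresholds give 3 + t <= 2 t, the smallness of the polynomial part, and [rad t] < x. *)
exists (Num.max 3 (Num.max (16 * p ^+ 2 / e) (- 2 * ln x))) => t.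
rewrite !ge_max => /and3P[t3 tp tx].
have rx : rad t < x.
  rewrite -[x]lnK ?posrE// /rad ltr_expR; lra.
have hr := h_incr (ltW (rad_gt0 t)) rx.
have h0 := h_ge0 (ltW (rad_gt0 t)).
have [eta1 etae] : eta <= 1 /\ eta <= e / c.
  by rewrite /eta !ge_min !lexx orbT.
have hsq : h (rad t) ^+ 2 <= e / c by rewrite hx in hr; nra.
have E1 : expR ((t + 1) / p) * expR (- (t / p)) = expR p^-1.
  rewrite -expRD; congr expR; field; lra.
have W2 : 32 * target (rad t) ^+ 2 / t * expR (- (t / p)) <= e / 2.
  rewrite sqr_target; last by lra.
  have -> : 32 * (expR ((t + 1) / p) * ((t + 1) / 2) * h (rad t) ^+ 2) / t * expR (-
    (t / p)) =
      32 * (expR ((t + 1) / p) * expR (- (t / p))) * ((t + 1) / 2 / t) * h (rad t) ^+ 2.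
    by field; lra.
  rewrite E1.
  apply: (@le_trans _ _ (32 * expR p^-1 * 1 * (e / c))).
    apply: ler_pM => //; rewrite ?sqr_ge0//.
      by rewrite !mulr_ge0 ?expR_ge0 ?invr_ge0//; lra.
    rewrite ler_pM2l ?mulr_gt0 ?expR_gt0// ler_pdivrMr; lra.
  rewrite /c le_eqVlt; apply/orP; left; apply/eqP; field.
  by rewrite gt_eqF ?expR_gt0.
have W1 : (3 + t) * expR (- (t / p)) <= e / 2.
  have tp0 : 0 < t / p by rewrite divr_gt0; lra.
  have e1 := expR_ge_sqr (ltW tp0).
  rewrite expRN ler_pdivrMr ?expR_gt0//.
  apply: (@le_trans _ _ (e / 2 * ((t / p) ^+ 2 / 4))); last by rewrite ler_pM2l//; lra.
  move: tp; rewrite ler_pdivrMr// => tp.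
  have -> : e / 2 * ((t / p) ^+ 2 / 4) = (t * e) * t / (8 * p ^+ 2) by field; lra.
  have p2 : 0 < p ^+ 2 by rewrite exprn_gt0//; lra.
  rewrite ler_pdivlMr; last by lra.
  have : 16 * p ^+ 2 * t <= t * e * t by rewrite ler_pM2r//; lra.
  have : p ^+ 2 * 3 <= p ^+ 2 * t by rewrite ler_pM2l.
  lra.
rewrite /weight mulrDl; lra.
Qed.

Lemma sparse_sequence (P : nat -> R -> Prop) :
  (forall n, exists t0, forall t, t0 <= t -> P n t) ->
  exists T : nat -> R, [/\ 1 <= T 0, forall n, 2 * T n <= T n.+1 & forall n, P n (T n)].
Proof.
move=> /choice[th thP].
pose T := fix T n := if n is m.+1 then Num.max (2 * T m) (th m.+1) else Num.max 1 (th
  0).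
exists T; split=> [|n|[|n]]; rewrite /= ?le_max ?lexx//; apply: thP.
- by rewrite le_max lexx orbT.
- by rewrite [T _]/= le_max lexx orbT.
Qed.

(** The weight to the power p times the squared radius exp (- t) is the p-th power of weight * exp
    (- t / p). Once that quantity is at most 1, its p-th power is at most itself, so [weight_small]
    is enough. *)
Lemma sparse_weight_sequence : exists T : nat -> R,
  [/\ 1 <= T 0, forall n, 2 * T n <= T n.+1 &
     forall n, 4 * (weight (T n) `^ p * expR (- (T n / 2)) ^+ 2) <= 1 / (2 ^ n.+1)%:R].
Proof.
have p1 := p_gt1.
have [|T [T0 TS TP]] := @sparse_sequence (fun n t => 1 <= t /\
    weight t * expR (- (t / p)) <= (4 * (2 ^ n.+1)%:R)^-1).
  move=> n; have e0 : 0 < (4 * (2 ^ n.+1)%:R)^-1 :> R.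
    by rewrite invr_gt0 mulr_gt0// ltr0n expn_gt0.
  have [t0 H0] := weight_small e0.
  by exists (Num.max 1 t0) => t; rewrite ge_max => /andP[t1 /H0].
exists T; split=> // n; have [t1 Ht] := TP n.
set k : R := (2 ^ n.+1)%:R in Ht *.
have k1 : 1 <= k by rewrite ler1n expn_gt0.
set w := weight (T n) * _ in Ht.
have W0 : 0 < weight (T n).
  have T1 : 0 <= T n by lra.
  have b0 : 0 <= 32 * target (rad (T n)) ^+ 2 / T n.
    by rewrite divr_ge0// mulr_ge0// sqr_ge0.
  by rewrite /weight; lra.
have w0 : 0 < w by rewrite mulr_gt0 ?expR_gt0.
have -> : weight (T n) `^ p * expR (- (T n / 2)) ^+ 2 = w `^ p.
  rewrite powRM ?expR_ge0 ?(ltW W0)// -expRM expr2 -expRD; congr (_ * expR _).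
  by field; lra.
have w1 : w <= 1.
  by apply: le_trans Ht _; rewrite invf_le1; lra.
have : w `^ p <= w by apply: ge1r_powR; [rewrite w0 w1|exact: ltW p1].
rewrite invfM in Ht; lra.
Qed.

End SparseScales.

(** As d <= 2, 8 b^2 d^2 <= (8 b^2 / a) (2 a d) and 4 (a d)^2 <= 4 a (2 a d). The Jacobian in the
    denominator thus turns b^2 into b^2 / a. *)
Lemma distortion_spike_le (R : realType) (a b d : R) : 0 < a -> 0 <= d <= 2 ->
  (4 * (a * d) ^+ 2 + 4 * (a * d) + 3 + 8 * (b * d) ^+ 2) / (1 + 2 * (a * d)) <=
    3 + 4 * a + 8 * b ^+ 2 / a.
Proof.
move=> a0 /andP[d0 d2]; have ad0 : 0 <= a * d by rewrite mulr_ge0// ltW.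
rewrite ler_pdivrMr; last by lra.
have -> : (3 + 4 * a + 8 * b ^+ 2 / a) * (1 + 2 * (a * d)) =
  3 + 4 * a + 8 * (b ^+ 2 / a) + 6 * (a * d) + 8 * a * (a * d) + 16 * (b ^+ 2 * d).
  by field; lra.
have q0 : 0 <= b ^+ 2 / a by rewrite divr_ge0 ?sqr_ge0// ltW.
have h1 : b ^+ 2 * d * d <= b ^+ 2 * d * 2 by rewrite ler_wpM2l// mulr_ge0// sqr_ge0.
have h2 : a * d * (a * d) <= a * d * (a * 2) by rewrite ler_wpM2l// ler_wpM2l// ltW.
rewrite !exprMn (expr2 d); lra.
Qed.

Lemma modulus_powR_le (R : realType) (d alpha : R) : 0 <= d -> d < 1 -> 3 < alpha ->
  d `^ alpha <= d * Num.min 1 d ^+ 2.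
Proof.
move=> d0 d1 a3; have [->|dn] := eqVneq d 0.
  by rewrite powR0 ?mul0r//; lra.
have dp : 0 < d by rewrite lt_neqAle eq_sym dn.
rewrite (min_idPr (ltW d1)) -exprS -powR_mulrn//.
by apply: ger_powR; [rewrite dp ltW|exact: ltW].
Qed.

Lemma cvg_rad (R : realType) (T : nat -> R) : (forall n, n%:R + 1 <= T n) ->
  rad (T n) @[n --> \oo] --> (0 : R).
Proof.
move=> HT; apply/cvgrPdist_lt => e e0; near=> n.
rewrite sub0r normrN gtr0_norm ?rad_gt0// /rad expRN invf_plt ?posrE ?expR_gt0//.
apply: lt_le_trans (expR_ge1Dx _).
have : 2 / e <= n%:R by near: n; exact: nbhs_infty_ger.
have := HT n; lra.
Unshelve. all: by end_near. Qed.

(** * Assembly of the spiral *)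

Theorem theorem3 (R : realType) (h : R -> R) (p : R)
    (h_homeo : homeomorphism (`[0, +oo[ : set R) (`[0, +oo[ : set R) h)
    (h_incr : {in `[0, +oo[ &, {homo h : x y / x < y}})
    (p_gt1 : 1 < p) :
  exists f : plane R -> plane R,
    homeomorphism setT setT f /\
    [/\ exists K : plane R -> \bar R, finite_distortion f K /\ Lp_loc p K,
        f (0, 0) = (0, 0) /\ f (1, 0) = (1, 0),
        forall alpha : R, 3 * p / (p - 1) < alpha ->
          exists2 C : R, 0 < C &
            forall x y : plane R, modulus (x - y) < 1 ->
              C * modulus (x - y) `^ alpha <= modulus (f x - f y) &
        exists2 theta : R -> R, arg_branch f theta &
          exists r : nat -> R,
            [/\ decreasing_seq r,
                forall n, 0 < r n <= 1,
                r n @[n --> \oo] --> 0 &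
                forall n,
                  r n `^ (- p^-1) * ln (r n)^-1 `^ 2^-1 * h (r n)
                    <= `|theta (r n)|]].
Proof.
have h_ge0 x : 0 <= x -> 0 <= h x.
  case: h_homeo => g [_ _ H _] x0.
  by have [] := H x; rewrite /= in_itv /= andbT.
have h_lt x y : 0 <= x -> x < y -> h x < h y.
  move=> x0 xy; apply: h_incr => //; rewrite in_itv /= andbT//.
  by rewrite (le_trans x0)// ltW.
have h_small e : 0 < e -> exists2 x, 0 < x & h x = e.
  case: h_homeo => g [_ _ _ H] e0.
  have [|g0 hg] := H e; first by rewrite /= in_itv /= andbT ltW.
  move: g0; rewrite /= in_itv /= andbT le_eqVlt => /orP[/eqP g0|g0];
    last by exists (g e).
  (* If e were attained at 0, the preimage of e / 2 would contradict monotonicity. *)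
  have [|k0 hk] := H (e / 2); first by rewrite /= in_itv /= andbT; lra.
  move: k0; rewrite /= in_itv /= andbT => k0.
  have : h 0 <= h (g (e / 2)).
    by move: k0; rewrite le_eqVlt => /orP[/eqP <-//|k0]; exact/ltW/h_lt.
  by rewrite hk g0 hg; lra.
have [T [T0 TS TW]] := sparse_weight_sequence p_gt1 h_ge0 h_lt h_small.
(* The divisor 4 yields A t <= t / 2, and b n is the rotation required at radius [rad (T n)]. *)
pose a n := T n / 4; pose b n := target h p (rad (T n)).
have T1 n : 1 <= T n by exact: sparse_ge1.
have a_gt0 n : 0 < a n by rewrite /a; have := T1 n; lra.
have a_ge0 n : 0 <= a n by exact: ltW.
have b_ge0 n : 0 <= b n by exact: target_ge0.
pose A := train T a; pose B := train T b; pose dA := dtrain T a; pose dB := dtrain T b.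
have A_derive : forall t : R, is_derive t 1 A (dA t) by exact: is_derive_train.
have B_derive : forall t : R, is_derive t 1 B (dB t) by exact: is_derive_train.
have A_homo : {homo A : s t / s <= t} by exact: train_homo.
have B_homo : {homo B : s t / s <= t} by exact: train_homo.
have A_ge0 t : 0 <= A t by exact: train_ge0.
have B_ge0 t : 0 <= B t by exact: train_ge0.
have A_eq0 t : t <= 0 -> A t = 0 by exact: train_eq0.
have B0 : B 0 = 0 by exact: train_eq0.
have A_le t : 0 <= t -> A t <= t / 2.
  move=> t0; have := train_sparse_le T0 TS t0.
  have -> : A t = train T T t / 4.
    by rewrite /A /train mulr_suml; apply: eq_bigr => n _; rewrite /a; ring.
  by move: (train _ _ _) => x; lra.
have dA_ge0 t : 0 <= dA t.
  by apply: sumr_ge0 => n _; rewrite mulr_ge0// dstep_ge0.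
pose C := 4 * expR 2^-1 * h 1 + 1.
have C_gt0 : 0 < C by rewrite ltr_wpDl// !mulr_ge0 ?expR_ge0 ?h_ge0.
have B_le s t : s <= t -> `|B t - B s| <= C * expR (t / 2) * (A t - A s).
  move=> st; rewrite ger0_norm ?subr_ge0 ?B_homo//.
  (* Only steps with T n <= t count, so exp (T n / 2) <= exp (t / 2). *)
  apply: train_comparison => // n Tt.
  apply: (le_trans (target_le p_gt1 h_ge0 h_lt (T1 n))).
  by rewrite -/C ler_pM2r ?a_gt0// ler_pM2l// ler_expR; lra.
have lower := spiral_lower_bound A_homo A_eq0 A_le C_gt0 B_le.
exists (spiral A B); split.
  apply: (@spiral_homeomorphism _ _ _ _ _ _ _ (16 * (1 + C))) => //.
  - exact: continuous_train.
  - exact: continuous_train.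
  - by lra.
(* The outer radius of the n-th annulus, at depth T n; the inner one is [rad (T n)]. *)
pose r0 n := expR (- (T n / 2)).
pose c n := weight h p (T n) `^ p.
have c_ge0 n : 0 <= c n by exact: powR_ge0.
(* The distortion formula takes the value 3 where dA and dB vanish. *)
pose G := square_series (3 `^ p) c r0.
have p_ge1 : 1 <= p by exact: ltW.
split.
- apply: (@spiral_finite_distortion _ _ _ dA dB _ G) => //.
  + exact: continuous_dtrain.
  + exact: continuous_dtrain.
  + by apply: measurable_square_series.
  + move=> M M0; apply: integral_square_series_lty => // n; exact: expR_gt0.
  move=> z; have [H|[n [n1 n2 H]]] := dtrain_spike T0 TS (tau z).
    apply: le_trans (square_series_ge0 _ _ _ _) => //.
    rewrite /distortion /dA /dB !H lee_fin.
    by rewrite expr0n /= !mulr0 !add0r !addr0 divr1.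
  (* The convention ln 0 = 0 puts the origin at depth 0, whereas the spikes lie deeper than T n >=
     1. *)
  have z0 : z != (0, 0).
    apply/eqP => z0; move: n1; rewrite z0 /tau /sqmod /= expr0n addr0 ln0// oppr0.
    by have := T1 n; lra.
  have zn : square (r0 n) z.
    have mz : modulus z <= r0 n by rewrite modulus_tau// ler_expR; lra.
    by apply/in_square; split; apply: le_trans mz;
      [exact: ler_norm_modulus1|exact: ler_norm_modulus2].
  have Gn : ((c n)%:E <= G z)%E by apply: square_series_ge_coef => //; exact: powR_ge0.
  apply: le_trans Gn.
  have K1 := distortion_ge dB dA_ge0 (tau z).
  have dA0 := dA_ge0 (tau z).
  have le : distortion dA dB (tau z) <= weight h p (T n).
    rewrite /distortion /dA /dB !H.
    apply: le_trans (distortion_spike_le _ _ _) _ => //.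
      by rewrite dstep_ge0 dstep_le2.
    rewrite le_eqVlt; apply/orP; left; apply/eqP; rewrite /weight /a /b.
    by field; have := T1 n; lra.
  by rewrite lee_fin; apply: ge0_ler_powR => //; rewrite ?nnegrE; lra.
- split; first exact: spiral0.
  exact: spiral1.
- move=> alpha ha; have a3 : 3 < alpha.
    apply: le_lt_trans ha; rewrite ler_pdivlMr; lra.
  have C16 : 0 < 16 * (1 + C) by lra.
  exists (16 * (1 + C))^-1 => [|x y xy]; first by rewrite invr_gt0.
  rewrite ler_pdivrMl//; apply: le_trans (lower x y).
  by apply: modulus_powR_le => //; exact: modulus_ge0.
pose i (r : R) : plane R := (r, 0).
have i0 r : 0 < r -> i r != (0, 0).
  by move=> r0'; rewrite xpair_eqE negb_and gt_eqF.
(* A positive real has argument 0, so B alone is the argument of its image. *)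
exists (fun r => B (tau (i r))).
  split.
  - apply: continuous_in_subspaceT => r; rewrite inE /= in_itv /= => /andP[r1 _].
    apply: (@continuous_comp _ _ _ i (fun z => B (tau z))).
      have cid : (fun y : R => y) x @[x --> r] --> r by exact: cvg_id.
      have ccst : (fun _ : R => 0 : R) x @[x --> r] --> (0 : R) by exact: cvg_cst.
      exact: (cvg_pair cid ccst).
    apply: (@continuous_comp _ _ _ (@tau R) B); first exact: continuous_tau (i0 _ r1).
    exact: continuous_train.
  - by rewrite /i /tau /sqmod /= expr1n expr0n addr0 ln1 oppr0.
  - move=> r /andP[r1 _]; rewrite modulus_spiral.
    have -> : modulus (r, 0) = r.
      by rewrite /modulus /= expr0n addr0 sqrtr_sqr gtr0_norm.
    by rewrite /spiral /cmul /= /i; congr pair; ring.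
exists (fun n => rad (T n)); split.
- by apply/decreasing_seqP => n; rewrite ltr_expR; have := TS n; have := T1 n; lra.
- by move=> n; rewrite rad_gt0 rad_le1//; have := T1 n; lra.
- by apply: cvg_rad; exact: sparse_ge.
- move=> n; rewrite ger0_norm//.
  (* At this depth the n-th step is complete, so B has reached at least b n. *)
  have -> : tau (i (rad (T n))) = T n + 1.
    rewrite /tau /sqmod /= expr0n addr0 expr2 -expRD expRK; lra.
  by apply: (@train_ge_coef _ _ T0 TS b).
Qed.
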